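(* Let $\Bbbk$ be an algebraically closed field with $p=\operatorname{char}\Bbbk>0$. Let $A'$ and $A''$ be finite subsets of free abelian groups $M'$ and $M''$ (of finite rank) respectively such that $\operatorname{Aff}(A')=M'$ and $\operatorname{Aff}(A'')=M''$. Let $c>0$ be an integer coprime to $p$. Assume $n:=\operatorname{rk}(M')+\operatorname{rk}(M'')\ge\#A'-1$ and $\operatorname{rk}(M'')\ge1$. Then there exists a finite subset $A\subset M:=\mathbb{Z}^n$ with $\#A=n+\#A''$ and $\operatorname{Aff}(A)=M$ such that the Gauss map $\gamma$ of $X_A\subset\mathbb{P}^{\#A-1}$ satisfies the following conditions: (i) (The closure of) each irreducible component of a general fiber of $\gamma$ is projectively equivalent to $X_{A'}$. (ii) (The closure of) the image $\gamma(X_A)$ is projectively equivalent to $X_{A''}$. (iii) The number of the irreducible components of a general fiber of $\gamma$ is equal to $c$.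
   Context: For a free abelian group $M$ of finite rank, $T_M=\operatorname{Spec}\Bbbk[M]$, where $\Bbbk[M]=\bigoplus_{u\in M}\Bbbk z^u$. For a finite subset $A=\{u_0,\ldots,u_N\}\subset M$ (distinct elements), $X_A\subset\mathbb{P}^N$ is the closure of the image of $T_M\to\mathbb{P}^N$, $t\mapsto[z^{u_0}(t):\cdots:z^{u_N}(t)]$, and $\operatorname{Aff}(A)\subset M$ is the set of all $\sum_i a_iu_i$ with $a_i\in\mathbb{Z}$, $\sum_i a_i=1$. The Gauss map of an $n$-dimensional projective variety $X\subset\mathbb{P}^N$ is the rational map $\gamma: X\dashrightarrow\mathbb{G}(n,\mathbb{P}^N)$ sending each smooth point $x$ to the embedded tangent space $\mathbb{T}_xX\subset\mathbb{P}^N$. Irreducible components of fibers are considered with the reduced structure, and their closures are taken in $X$; the closure of the image of $\gamma$ is regarded as a projective variety via the Plücker embedding of the Grassmannian. $X_1\subset\mathbb{P}^{N_1}$ and $X_2\subset\mathbb{P}^{N_2}$ are projectively equivalent if there are linear embeddings $\jmath_i:\mathbb{P}^{N_i}\hookrightarrow\mathbb{P}^{m}$ (i.e. $\jmath_i^*\mathcal{O}(1)=\mathcal{O}(1)$) for some $m$ with $\jmath_1(X_1)=\jmath_2(X_2)$. *)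

(* Defs.v *)
From HB Require Import structures.
From mathcomp Require Import all_boot all_order all_algebra.
From mathcomp Require Import boolp classical_sets cardinality.
From mathcomp Require Import mpoly.

Set Implicit Arguments.
Unset Strict Implicit.
Unset Printing Implicit Defensive.

Import GRing.Theory.
Local Open Scope classical_set_scope.
Local Open Scope card_scope.
Local Open Scope ring_scope.

(* A point of the projective space P^(m-1) over k is given by its homogeneous
   coordinate vectors, the nonzero x : 'rV[k]_m; a subset of P^(m-1) is the set
   of all homogeneous coordinate vectors of its points, hence a subset of
   'rV[k]_m \ {0} stable under nonzero scalars.  Varieties are identified with
   their sets of closed points, k being algebraically closed. *)

Section Zariski.
Variables (k : fieldType) (m : nat).
Implicit Types (X Y Z F C : set 'rV[k]_m) (S : set {mpoly k[m]}).

Definition homog_polys : set {mpoly k[m]} :=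
  [set f | exists e : nat, f \is e.-homog].

Definition zero_locus S : set 'rV[k]_m :=
  [set x : 'rV[k]_m | x != 0 /\ forall f, S f -> f.@[x 0] = 0].

(* The homogeneous elements of the ideal of X. *)
Definition homog_ideal X : set {mpoly k[m]} :=
  [set f | homog_polys f /\ forall x, X x -> f.@[x 0] = 0].

Definition zclosed Z : Prop :=
  exists S, S `<=` homog_polys /\ Z = zero_locus S.

Definition zclosure X : set 'rV[k]_m := zero_locus (homog_ideal X).

Definition irreducible Z : Prop :=
  Z !=set0 /\
  forall C1 C2, zclosed C1 -> zclosed C2 -> Z `<=` C1 `|` C2 ->
    Z `<=` C1 \/ Z `<=` C2.

(* Maximal irreducible subsets; F need not be closed in the projective space,
   and the components are then closed in F only. *)
Definition irr_component F Z : Prop :=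
  [/\ irreducible Z, Z `<=` F &
      forall Z', irreducible Z' -> Z' `<=` F -> Z `<=` Z' -> Z' = Z].

(* P holds at a general point of Y: on a dense Zariski-open subset Y \ C. *)
Definition general_point Y (P : 'rV[k]_m -> Prop) : Prop :=
  exists C, [/\ zclosed C, Y `<=` zclosure (Y `\` C) &
                forall y, Y y -> ~ C y -> P y].

(* The function field of X contains d algebraically independent elements
   f_i / g, where the f_i and g are homogeneous of the same degree; g is not
   identically zero on X, as the condition on q = 1 shows. *)
Definition alg_indep_functions X (d : nat) : Prop :=
  exists (e : nat) (f : 'I_d -> {mpoly k[m]}) (g : {mpoly k[m]}),
    [/\ forall i, f i \is e.-homog, g \is e.-homog &
        forall q : {mpoly k[d]},
          (forall x, X x -> g.@[x 0] != 0 ->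
             q.@[fun i => (f i).@[x 0] / g.@[x 0]] = 0) -> q = 0].

(* The dimension of a projective variety X, as the transcendence degree of its
   function field. *)
Definition has_dim X (d : nat) : Prop :=
  alg_indep_functions X d /\ ~ alg_indep_functions X d.+1.

(* The linear subspace of k^m whose projectivization is the embedded tangent
   space of X at x. *)
Definition tangent_space X (x : 'rV[k]_m) : set 'rV[k]_m :=
  [set v | forall f, homog_ideal X f ->
             \sum_(i < m) (f^`M(i)).@[x 0] * v 0 i = 0].

(* x is a smooth point of X, dim X = d, and the rows of B form a basis of the
   tangent space.  By the Jacobian criterion, x is smooth if and only if this
   linear subspace has dimension dim X + 1. *)
Definition gauss_basis d X (x : 'rV[k]_m) (B : 'M[k]_(d.+1, m)) : Prop :=
  [/\ has_dim X d, X x, row_free B &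
      [set v : 'rV[k]_m | (v <= B)%MS] = tangent_space X x].

End Zariski.

Section Pluecker.
Variables (k : fieldType) (r m : nat).

(* Plücker coordinates are indexed by the increasing r-tuples of columns. *)
Definition pluecker_index : {set r.-tuple 'I_m} :=
  [set t : r.-tuple 'I_m | sorted ltn [seq val i | i <- t]].

Definition pluecker (B : 'M[k]_(r, m)) : 'rV[k]_#|pluecker_index| :=
  \row_(j < #|pluecker_index|) \det (colsub (tnth (enum_val j)) B).

End Pluecker.

Section GaussMap.
Variables (k : fieldType) (m d : nat) (X : set 'rV[k]_m).

Definition gauss_image : set 'rV[k]_#|pluecker_index d.+1 m| :=
  [set y | exists x (B : 'M[k]_(d.+1, m)),
             gauss_basis X x B /\ y = pluecker B].

Definition gauss_fiber (y : 'rV[k]_#|pluecker_index d.+1 m|) :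
    set 'rV[k]_m :=
  [set x | exists B : 'M[k]_(d.+1, m), gauss_basis X x B /\ y = pluecker B].

(* P holds for a general fiber of the Gauss map. *)
Definition general_gauss_fiber (P : set 'rV[k]_m -> Prop) : Prop :=
  general_point (zclosure gauss_image) (fun y => P (gauss_fiber y)).

End GaussMap.
Arguments gauss_image {k m} d X.
Arguments gauss_fiber {k m} d X y.
Arguments general_gauss_fiber {k m} d X P.

(* J1 and J2 are the matrices of the linear embeddings into P^m. *)
Definition proj_equiv (k : fieldType) (m1 m2 : nat)
    (X1 : set 'rV[k]_m1) (X2 : set 'rV[k]_m2) : Prop :=
  exists (m : nat) (J1 : 'M[k]_(m1, m.+1)) (J2 : 'M[k]_(m2, m.+1)),
    [/\ row_free J1, row_free J2 &
        [set x *m J1 | x in X1] = [set x *m J2 | x in X2]].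

Definition free_of_rank (M : zmodType) (r : nat) : Prop :=
  exists f : {additive M -> 'rV[int]_r}, bijective f.

Section Toric.
Variables (k : fieldType) (M : zmodType).

(* A closed point of T_M = Spec k[M] is a k-algebra morphism k[M] -> k; it is
   given by its values t u = z^u(t) on the monomials. *)
Definition torus : set (M -> k) :=
  [set t | t 0 = 1 /\ forall u v, t (u + v) = t u * t v].

Definition toric_variety (A : seq M) : set 'rV[k]_(size A) :=
  zclosure [set \row_(i < size A) t A`_i | t in torus].

Definition Aff (A : seq M) : set M :=
  [set x | exists a : 'I_(size A) -> int,
             \sum_(i < size A) a i = 1 /\
             x = \sum_(i < size A) A`_i *~ a i].

End Toric.
Arguments toric_variety k {M} A.

(* Main.v *)
Require Import Defs.
From HB Require Import structures.
From mathcomp Require Import all_boot all_order all_algebra.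
From mathcomp Require Import boolp classical_sets cardinality.
From mathcomp Require Import mpoly.
From mathcomp Require Import separable cyclotomic.

Set Implicit Arguments.
Unset Strict Implicit.
Unset Printing Implicit Defensive.

Import GRing.Theory.
Local Open Scope classical_set_scope.
Local Open Scope card_scope.
Local Open Scope ring_scope.

(** The toric variety is built so that its tangent spaces are as simple as
    possible. Let [x_1, ..., x_n] be the coordinates attached to a basis of the
    lattice [Z^n], and let all the other coordinates [y_j] have exponents
    divisible by [p], one of these exponents, that of [y_j0], being 0. In
    characteristic [p] the derivatives only see exponents modulo [p], so the
    tangent space at a point [t] of the torus is the coordinate subspace of the
    [x_i] plus the line spanned by the vector [(y_j(t))_j] ([tangent_pt]). The
    Gauss map on the torus is therefore [t |-> (y_j(t))_j], followed by a linear
    embedding into the Pluecker space ([pluecker_tangent_mx]): its image is the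
    toric variety of the exponents of the [y_j], and its fibers are the cosets
    of the group on which the characters [y_j / y_j0] are trivial.

    It remains to choose the lattice data. The differences of [A'] give a
    surjection [Z^n -> M'] sending the basis vectors to these differences,
    possible because [n >= #A' - 1]; its kernel is free of rank [rk M''].
    Identify this kernel with [M''] and take for the [y_j] the differences of
    [A''], dilated by [p * diag(c, 1, ..., 1)]. A coset of the kernel of the
    Gauss map then has [c] components, indexed by the [c]-th roots of unity,
    as the factor [p] is invisible on points. On each component the [x_i] are,
    up to constants, the characters in [A'] and the [y_j] are constant, so its
    closure is the toric variety of [A'] in repeated coordinates
    ([coset_component_proj_equiv]).

    The definitions of the image and of the fibers refer to all smooth points,
    hence also to smooth points of [X] outside the torus, and the real work is
    to control them. Two facts are needed: their Gauss images lie in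
    the closure of the image of the torus ([gauss_closure], by writing the
    tangent direction with minors of a Jacobian matrix), and those lying in a
    general fiber are in the closure of the part of this fiber in the torus
    ([fiber_closure], from [gauss_laurent_val]). Both arguments work directly
    with equations. The basic tool is the independence of characters
    ([dedekind], [mon_indep]): it makes the ideal of a toric variety graded
    by weights, and it splits the equations of a fiber along the characters of
    the kernel of the Gauss map. The dimension of [X] comes from counting
    characters ([not_alg_indep_toric]). *)

(** * Independence of characters *)

(** Dedekind's independence of characters, for a family in which several
    members may coincide on [H]: combining a relation with its translate by a
    point that separates two characters removes one term of the family.
    Grouping the terms by equality on [H] makes the lemma apply both to the
    whole torus and to the kernel of the Gauss map. *)
Lemma dedekind (T I : eqType) (op : T -> T -> T) (H : set T) (K : fieldType)
    (chi : I -> T -> K)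
    (H_op : forall x y, H x -> H y -> H (op x y))
    (chiM : forall i x y, H x -> H y -> chi i (op x y) = chi i x * chi i y)
    (chi_neq0 : forall i x, H x -> chi i x != 0)
    (s : seq I) (c : I -> K) :
  H !=set0 -> (forall x, H x -> \sum_(i <- s) c i * chi i x = 0) ->
  forall i0, \sum_(i <- s | `[< forall x, H x -> chi i x = chi i0 x >]) c i = 0.
Proof.
move=> [h0 Hh0].
have [N leN] := ubnP (size s); elim: N s c leN => // N IHN s c leN sum0 i0.
pose P i := `[< forall x, H x -> chi i x = chi i0 x >].
have [/allP allP|/allPn[j js nPj]] := boolP (all P s).
  have := sum0 _ Hh0; rewrite big_seq.
  rewrite (eq_bigr (fun i => c i * chi i0 h0)); last first.
    by move=> i /allP /asboolP /(_ _ Hh0) ->.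
  rewrite -mulr_suml => /eqP; rewrite mulf_eq0 (negPf (chi_neq0 _ _ Hh0)) orbF.
  move=> /eqP sc; apply: etrans sc; rewrite big_seq_cond.
  by apply: eq_bigl => i; case: (boolP (i \in s)) => // /allP.
have [x0 Hx0 neq0] : exists2 x0, H x0 & chi j x0 != chi i0 x0.
  apply: contrapT => nex; move: nPj => /asboolP; apply=> x Hx.
  by apply/eqP; apply: contrapT => /negP neq; apply: nex; exists x.
pose c' i := c i * (chi i x0 - chi j x0).
have szr : (size (rem j s) < N)%N.
  by rewrite size_rem //; case: (s) js leN.
have := IHN (rem j s) c' szr.
have sum' x : H x -> \sum_(i <- rem j s) c' i * chi i x = 0.
  move=> Hx.
  have: \sum_(i <- s) c' i * chi i x = 0.
    rewrite (eq_bigr (fun i => c i * chi i (op x0 x) - chi j x0 * (c i * chi i x))).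
      by rewrite big_split /= sumrN -mulr_sumr !sum0 ?mulr0 ?subr0 //; apply: H_op.
    by move=> i _; rewrite chiM // /c' mulrBr mulrBl -!mulrA [c i * (chi j x0 * _)]mulrCA.
  by rewrite (perm_big _ (perm_to_rem js)) big_cons /= /c' subrr mulr0 mul0r add0r.
move=> /(_ sum' i0).
rewrite (eq_bigr (fun i => c i * (chi i0 x0 - chi j x0))); last first.
  by move=> i /asboolP e; rewrite /c' (e _ Hx0).
rewrite -mulr_suml => /eqP; rewrite mulf_eq0 subr_eq0 [chi i0 x0 == _]eq_sym.
rewrite (negPf neq0) orbF => /eqP sc.
by rewrite (perm_big _ (perm_to_rem js)) big_cons /= -/(P j) (negPf nPj).
Qed.

(** Turns the vanishing of the coefficient sums of every class, as produced by
    [dedekind], into the vanishing of the sums in which each coefficient is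
    multiplied by a factor that depends on its class only. *)
Lemma sum_over_classes (I : eqType) (K : pzRingType) (E : rel I) (s : seq I) (c phi : I -> K) :
  equivalence_rel E -> {in s, forall i0, \sum_(i <- s | E i i0) c i = 0} ->
  (forall i j, i \in s -> j \in s -> E i j -> phi i = phi j) ->
  \sum_(i <- s) c i * phi i = 0.
Proof.
move=> eqE; have [N leN] := ubnP (size s); elim: N s leN => // N IHN s leN c0 phiE.
case: s => [|i0 s] in leN c0 phiE *; first by rewrite big_nil.
have reflE i : E i i by have [] := eqE i i i.
rewrite (bigID (fun i => E i i0)) /= [X in X + _](_ : _ = 0) ?add0r; last first.
  rewrite big_seq_cond (eq_bigr (fun i => c i * phi i0)); last first.
    by move=> i /andP[si Ei]; rewrite (phiE i i0) ?mem_head.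
  by rewrite -mulr_suml -big_seq_cond c0 ?mem_head ?mul0r.
rewrite -big_filter; set s' := filter _ _.
have s's i : i \in s' -> i \in i0 :: s /\ ~~ E i i0 by rewrite mem_filter => /andP[].
apply: IHN => [|i1 /s's[si1 ni1]|i j /s's[si _] /s's[sj _]]; last exact: phiE.
  rewrite size_filter /= reflE /= add0n; apply: leq_ltn_trans (count_size _ _) _.
  by move: leN.
rewrite big_filter_cond -[RHS](c0 i1) //; apply: eq_bigl => i.
case: (boolP (E i i1)) => [Ei|]; rewrite ?andbF // andbT.
have [_ /(_ Ei) Ei'] := eqE i i1 i0.
by rewrite Ei' ni1.
Qed.

(** * Homogeneous polynomials and projective closures *)

Section Homogeneous.
Variable k : fieldType.
Implicit Types n l d e : nat.

Lemma meval_dhomogZ n d (f : {mpoly k[n]}) (c : k) (x : 'rV[k]_n) :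
  f \is d.-homog -> f.@[(c *: x) 0] = c ^+ d * f.@[x 0].
Proof.
move=> /dhomogP f_d; rewrite !mevalE mulr_sumr big_seq [RHS]big_seq.
apply: eq_bigr => a /f_d ad; have <- : mdeg a = d by [].
rewrite mulrCA; congr (_ * _).
rewrite mdegE -prodrXr -big_split /=.
by apply: eq_bigr => i _; rewrite mxE exprMn.
Qed.

Lemma dhomog_comp n l d e (f : {mpoly k[n]}) (F : 'I_n -> {mpoly k[l]}) :
  f \is d.-homog -> (forall i, F i \is e.-homog) ->
  f \mPo [tuple F i | i < n] \is (e * d).-homog.
Proof.
move=> /dhomogP f_d F_e; rewrite comp_mpolyEX big_seq rpred_sum // => a /f_d ad.
have <- : mdeg a = d by [].
rewrite rpredZ // comp_mpolyX mdegE.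
elim/big_rec2: _ => [|i b g _ Hg]; first by rewrite muln0 dhomog1.
by rewrite mulnDr dhomogM // dhomogMn // tnth_mktuple.
Qed.

Lemma meval_comp n l (f : {mpoly k[n]}) (F : 'I_n -> {mpoly k[l]}) v :
  (f \mPo [tuple F i | i < n]).@[v] = f.@[fun i => (F i).@[v]].
Proof.
by rewrite comp_mpoly_meval; apply: meval_eq => i; rewrite tnth_mktuple.
Qed.

Definition linform n l (M : 'M[k]_(n, l)) (j : 'I_l) : {mpoly k[n]} :=
  \sum_(i < n) M i j *: 'X_i.

Lemma linform_dhomog n l (M : 'M[k]_(n, l)) j : linform M j \is 1.-homog.
Proof. by apply: rpred_sum => i _; rewrite rpredZ // dhomogX; apply/eqP/mdeg1. Qed.

Lemma linform_eval n l (M : 'M[k]_(n, l)) j (x : 'rV[k]_n) :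
  (linform M j).@[x 0] = (x *m M) 0 j.
Proof.
rewrite /linform raddf_sum mxE; apply: eq_bigr => i _ /=.
by rewrite mevalZ mevalXU mulrC.
Qed.

End Homogeneous.

Section ZariskiTopology.
Variables (k : fieldType) (m : nat).
Implicit Types (S X Y Z : set 'rV[k]_m) (x : 'rV[k]_m).

Lemma zclosureP S x : zclosure S x <->
  x != 0 /\ forall d (f : {mpoly k[m]}), f \is d.-homog ->
    (forall y, S y -> f.@[y 0] = 0) -> f.@[x 0] = 0.
Proof.
split=> -[x0 Hx]; split=> //.
  by move=> d f fd Sf; apply: Hx; split=> //; exists d.
by move=> f [[d fd] Sf]; apply: Hx fd _.
Qed.

Lemma sub_zclosure S : (forall x, S x -> x != 0) -> S `<=` zclosure S.
Proof. by move=> S0 x Sx; apply/zclosureP; split=> [|d f _ Sf]; [exact: S0|exact: Sf]. Qed.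

Lemma zclosure_homog S d (f : {mpoly k[m]}) : f \is d.-homog ->
  (forall y, S y -> f.@[y 0] = 0) -> forall x, zclosure S x -> f.@[x 0] = 0.
Proof. by move=> fd Sf x /zclosureP[_ Hx]; apply: Hx fd Sf. Qed.

Lemma zclosure_sub S1 S2 : S1 `<=` zclosure S2 -> zclosure S1 `<=` zclosure S2.
Proof.
move=> S12 x /zclosureP[x0 Hx]; apply/zclosureP; split=> // d f fd S2f.
by apply: (Hx _ _ fd) => y /S12; apply: zclosure_homog fd _ _.
Qed.

Lemma zclosureS S1 S2 : S1 `<=` S2 -> zclosure S1 `<=` zclosure S2.
Proof.
move=> S12 x /zclosureP[x0 Hx]; apply/zclosureP; split=> // d f fd S2f.
by apply: (Hx _ _ fd) => y /S12; apply: S2f.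
Qed.

Lemma zclosureZ S (c : k) x : c != 0 -> zclosure S x -> zclosure S (c *: x).
Proof.
move=> c0 /zclosureP[x0 Hx]; apply/zclosureP.
split=> [|d f fd Sf]; first by rewrite scaler_eq0 negb_or c0.
by rewrite (meval_dhomogZ _ _ fd) (Hx _ _ fd Sf) mulr0.
Qed.

Lemma zclosed_zclosure S : zclosed (zclosure S).
Proof. by exists (homog_ideal S); split=> // f []. Qed.

Lemma zclosureU S1 S2 : zclosure (S1 `|` S2) `<=` zclosure S1 `|` zclosure S2.
Proof.
move=> x /zclosureP[x0 Hx]; apply: contrapT => /not_orP[n1 n2].
have ex S : ~ zclosure S x -> exists d (f : {mpoly k[m]}),
    [/\ f \is d.-homog, forall y, S y -> f.@[y 0] = 0 & f.@[x 0] != 0].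
  move=> nS; apply: contrapT => nex; apply: nS; apply/zclosureP; split=> // d f fd Sf.
  by apply/eqP; apply: contrapT => /negP nf; apply: nex; exists d, f.
have [d1 [f1 [fd1 Sf1 nf1]]] := ex _ n1.
have [d2 [f2 [fd2 Sf2 nf2]]] := ex _ n2.
have Sf y : (S1 `|` S2) y -> (f1 * f2).@[y 0] = 0.
  by move=> [/Sf1|/Sf2] e; rewrite mevalM e ?mul0r ?mulr0.
have /eqP := Hx _ _ (dhomogM fd1 fd2) Sf.
by rewrite mevalM mulf_eq0 (negPf nf1) (negPf nf2).
Qed.

Lemma irreducible_sub_bigcup (I : eqType) (s : seq I) (S : I -> set 'rV[k]_m) Z :
  irreducible Z -> Z `<=` zclosure [set x | exists2 i, i \in s & S i x] ->
  exists2 i, i \in s & Z `<=` zclosure (S i).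
Proof.
move=> irrZ; elim: s => [|i s IHs] Zs.
  case: irrZ => -[z /Zs /zclosureP[_ Hz]] _.
  have H0 y : [set x | exists2 i, i \in [::] & S i x] y -> (1 : {mpoly k[m]}).@[y 0] = 0.
    by case.
  by have /eqP := Hz _ _ (dhomog1 _ _) H0; rewrite meval1 oner_eq0.
have : Z `<=` zclosure (S i) `|` zclosure [set x | exists2 i, i \in s & S i x].
  move=> z /Zs Hz; apply: zclosureU; apply: zclosureS Hz => x [j].
  rewrite inE => /predU1P[->|js] Sx; first by left.
  by right; exists j.
move=> /(irrZ.2 _ _ (zclosed_zclosure _) (zclosed_zclosure _))[Zi|Zs'].
  by exists i; rewrite ?mem_head.
by have [j js] := IHs Zs'; exists j; rewrite // inE js orbT.
Qed.

(** Irreducibility only depends on the ring of functions of a dense subset, and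
    need not be tested on closed sets: it passes from [S] to every set between
    [S] and its closure. The fibers of the Gauss map are not closed, hence
    this form. *)
Lemma irreducible_between S Z :
  S !=set0 -> S `<=` Z -> Z `<=` zclosure S ->
  (forall d1 d2 (f1 f2 : {mpoly k[m]}), f1 \is d1.-homog -> f2 \is d2.-homog ->
     (forall x, S x -> f1.@[x 0] * f2.@[x 0] = 0) ->
     (forall x, S x -> f1.@[x 0] = 0) \/ (forall x, S x -> f2.@[x 0] = 0)) ->
  irreducible Z.
Proof.
move=> [s0 Ss0] SZ ZS dom; split=> [|C1 C2]; first by exists s0; apply: SZ.
move=> [F1 [hF1 ->]] [F2 [hF2 ->]] ZC; apply: contrapT => /not_orP[n1 n2].
have ex F : F `<=` @homog_polys k m -> ~ (Z `<=` zero_locus F) ->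
    exists f, F f /\ exists x, S x /\ f.@[x 0] <> 0.
  move=> hF nF; apply: contrapT => nex; apply: nF => z Zz.
  have [z0 _] := (zclosureP _ _).1 (ZS _ Zz).
  split=> // f Ff; have [d fd] := hF _ Ff.
  apply: (zclosure_homog fd _ (ZS _ Zz)) => y Sy.
  by apply: contrapT => nf; apply: nex; exists f; split=> //; exists y.
have [f1 [Ff1 [x1 [Sx1 nf1]]]] := ex _ hF1 n1.
have [f2 [Ff2 [x2 [Sx2 nf2]]]] := ex _ hF2 n2.
have [d1 fd1] := hF1 _ Ff1; have [d2 fd2] := hF2 _ Ff2.
have prod0 x : S x -> f1.@[x 0] * f2.@[x 0] = 0.
  by move=> /SZ Zx; case: (ZC x Zx) => -[_ Hx];
    [rewrite (Hx _ Ff1) mul0r|rewrite (Hx _ Ff2) mulr0].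
by case: (dom _ _ _ _ fd1 fd2 prod0) => [/(_ _ Sx1)|/(_ _ Sx2)].
Qed.

End ZariskiTopology.

Section LinearEmbeddings.
Variables (k : fieldType) (m1 m2 : nat).

(** Both inclusions substitute linear forms into the equations; for the first
    one, a point of the closure lies in the image of [J] because the linear
    equations of that image vanish on the given points. *)
Lemma zclosure_linear (J : 'M[k]_(m1, m2)) (S : set 'rV[k]_m1) : row_free J ->
  zclosure [set x *m J | x in S] = [set x *m J | x in zclosure S].
Proof.
move=> freeJ; have [J' JJ'] := row_freeP freeJ.
rewrite eqEsubset; split=> [y /zclosureP[y0 Hy]|_ [x /zclosureP[x0 Hx] <-]].
  have yE : y *m J' *m J = y.
    apply/eqP; rewrite -subr_eq0 -[X in _ - X]mulmx1 -mulmxA -mulmxBr.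
    apply/eqP/rowP => j; rewrite [RHS]mxE -linform_eval.
    apply: (Hy _ _ (linform_dhomog _ _)) => _ [x _ <-].
    rewrite linform_eval mulmxBr mulmx1 mulmxA -[x *m J *m J']mulmxA JJ' mulmx1.
    by rewrite subrr mxE.
  exists (y *m J') => //; apply/zclosureP; split=> [|d f fd Sf].
    by apply: contraNneq y0 => e; rewrite -yE e mul0mx.
  have := Hy _ _ (dhomog_comp fd (linform_dhomog J')).
  rewrite meval_comp.
  rewrite (@meval_eq _ _ _ (fun i => (y *m J') 0 i)); last by move=> i; rewrite linform_eval.
  apply=> _ [x Sx <-]; rewrite meval_comp -[RHS](Sf _ Sx); apply: meval_eq => i.
  by rewrite linform_eval -mulmxA JJ' mulmx1.
apply/zclosureP; split=> [|d f fd Sf].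
  apply: contraNneq x0 => e; rewrite -[x]mulmx1 -JJ' mulmxA e mul0mx //.
have := Hx _ _ (dhomog_comp fd (linform_dhomog J)).
rewrite meval_comp.
rewrite (@meval_eq _ _ _ (fun i => (x *m J) 0 i)); last by move=> i; rewrite linform_eval.
apply=> z Sz; rewrite meval_comp -[RHS](Sf _ (ex_intro2 _ _ _ Sz erefl)); apply: meval_eq => i.
by rewrite linform_eval.
Qed.

Lemma proj_equiv_linear (J : 'M[k]_(m1, m2)) (X : set 'rV[k]_m1) : row_free J ->
  proj_equiv [set x *m J | x in X] X.
Proof.
move=> freeJ; pose E : 'M[k]_(m2, 1 + m2) := row_mx 0 1%:M.
have freeE : row_free E.
  apply/row_freeP; exists (col_mx 0 1%:M).
  by rewrite mul_row_col mul0mx mulmx1 add0r.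
exists m2, E, (J *m E); split=> //.
  by rewrite /row_free mxrankMfree.
rewrite eqEsubset; split=> [_ [_ [x Xx <-] <-]|_ [x Xx <-]].
  by exists x; rewrite // mulmxA.
by exists (x *m J); [exists x|rewrite mulmxA].
Qed.

End LinearEmbeddings.

(** * Characters of a torus *)

Section Characters.
Variables (k : fieldType) (r : nat).
Implicit Types (t : 'rV[k]_r) (u v : 'rV[int]_r).

Definition in_torus : set 'rV[k]_r := [set t | forall l, t 0 l != 0].

Definition mon t u : k := \prod_l t 0 l ^ u 0 l.

Definition tmul t t' : 'rV[k]_r := \row_l (t 0 l * t' 0 l).

Lemma mon0 t : mon t 0 = 1.
Proof. by rewrite /mon big1 // => l _; rewrite mxE expr0z. Qed.

Lemma mon_neq0 t u : in_torus t -> mon t u != 0.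
Proof. by move=> nt; apply/prodf_neq0 => l _; rewrite expfz_neq0. Qed.

Lemma monD t u v : in_torus t -> mon t (u + v) = mon t u * mon t v.
Proof.
move=> nt; rewrite /mon -big_split /=; apply: eq_bigr => l _.
by rewrite mxE expfzDr.
Qed.

Lemma monMn t u d : in_torus t -> mon t (u *+ d) = mon t u ^+ d.
Proof.
move=> nt; elim: d => [|d IHd]; first by rewrite mulr0n mon0.
by rewrite mulrS monD // IHd exprS.
Qed.

Lemma monN t u : in_torus t -> mon t (- u) = (mon t u)^-1.
Proof.
move=> nt; apply: (mulfI (mon_neq0 u nt)).
by rewrite -monD // subrr mon0 divff // mon_neq0.
Qed.

Lemma monB t u v : in_torus t -> mon t (u - v) = mon t u / mon t v.
Proof. by move=> nt; rewrite monD // monN. Qed.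

Lemma monMz t u (z : int) : in_torus t -> mon t (u *~ z) = mon t u ^ z.
Proof.
by move=> nt; case: z => d; rewrite ?NegzE ?mulrNz ?monN // -pmulrn monMn.
Qed.

Lemma mon_sum t (I : Type) (s : seq I) (P : pred I) (F : I -> 'rV[int]_r) : in_torus t ->
  mon t (\sum_(i <- s | P i) F i) = \prod_(i <- s | P i) mon t (F i).
Proof.
move=> nt; elim/big_rec2: _ => [|i b _ _ <-]; first by rewrite mon0.
by rewrite monD.
Qed.

Lemma in_torus_tmul t t' : in_torus t -> in_torus t' -> in_torus (tmul t t').
Proof. by move=> nt nt' l; rewrite mxE mulf_neq0. Qed.

Lemma mon_tmul t t' u : mon (tmul t t') u = mon t u * mon t' u.
Proof.
rewrite /mon -big_split /=; apply: eq_bigr => l _.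
by rewrite mxE expfzMl.
Qed.

Lemma in_torus_const1 : in_torus (const_mx 1).
Proof. by move=> l; rewrite mxE oner_neq0. Qed.

Lemma mon_const1 u : mon (const_mx 1) u = 1.
Proof. by rewrite /mon big1 // => l _; rewrite mxE exp1rz. Qed.

Lemma mon_delta t l : mon t (delta_mx 0 l) = t 0 l.
Proof.
rewrite /mon (bigD1 l) //= big1 ?mulr1; first by rewrite mxE !eqxx expr1z.
by move=> l' /negPf nl; rewrite mxE nl andbF expr0z.
Qed.

Definition one_coord (l : 'I_r) (z : k) : 'rV[k]_r :=
  \row_l' (if l' == l then z else 1).

Lemma in_torus_one_coord l z : z != 0 -> in_torus (one_coord l z).
Proof. by move=> z0 l'; rewrite mxE; case: ifP; rewrite ?oner_eq0. Qed.

Lemma mon_one_coord u l z : mon (one_coord l z) u = z ^ u 0 l.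
Proof.
rewrite /mon (bigD1 l) //= big1 ?mulr1; first by rewrite mxE eqxx.
by move=> l' /negPf nl; rewrite mxE nl exp1rz.
Qed.

End Characters.
Arguments in_torus {k r}.

Lemma mon_row_mx (k : fieldType) (r1 r2 : nat) (t : 'rV[k]_(r1 + r2))
    (u1 : 'rV[int]_r1) (u2 : 'rV[int]_r2) :
  mon t (row_mx u1 u2) = mon (lsubmx t) u1 * mon (rsubmx t) u2.
Proof.
rewrite /mon big_split_ord /=; congr (_ * _); apply: eq_bigr => l _.
  by rewrite row_mxEl mxE.
by rewrite row_mxEr mxE.
Qed.

(** A root of [X ^ (d + 1) - X + 1]: it is nonzero, and would give [1 = 0] if its
    [d]-th power were [1]. *)
Lemma closed_nonroot_of_unity (k : closedFieldType) (d : nat) :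
  (0 < d)%N -> exists2 x : k, x != 0 & x ^+ d != 1.
Proof.
move=> d0; have [x xE] := @solve_monicpoly k d.+1
  (fun i => if i == 0%N then -1 else if i == 1%N then 1 else 0) isT.
have {}xE : x ^+ d.+1 = x - 1.
  rewrite xE; case: d d0 {xE} => // d _; rewrite !big_ord_recl big1 /=.
    by rewrite expr0 !mulr1 mul1r /bump /= addr0 expr1 addrC.
  by move=> i _; rewrite mul0r.
exists x.
  by apply/eqP => x0; move/eqP: xE; rewrite x0 exprS mul0r sub0r eq_sym oppr_eq0 oner_eq0.
apply/eqP => xd; move/eqP: xE; rewrite exprS xd mulr1 -subr_eq0 opprB addrC subrK.
by rewrite oner_eq0.
Qed.

Lemma expz_sep (k : closedFieldType) (z z' : int) :
  (forall x : k, x != 0 -> x ^ z = x ^ z') -> z = z'.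
Proof.
move=> sep; apply/eqP; rewrite -subr_eq0 -absz_eq0 -leqn0 leqNgt.
apply/negP => d0; have [x x0 /eqP[]] := closed_nonroot_of_unity k d0.
have e : x ^ (z - z') = 1 by rewrite expfzDr // -invr_expz -sep // divff // expfz_neq0.
case: (z - z') e => // d; rewrite /exprz => /(congr1 GRing.inv).
by rewrite invrK invr1.
Qed.

Lemma mon_sep (k : closedFieldType) (r : nat) (u v : 'rV[int]_r) :
  (forall t : 'rV[k]_r, in_torus t -> mon t u = mon t v) -> u = v.
Proof.
move=> sep; apply/rowP => l; apply: (@expz_sep k) => x x0.
by rewrite -!mon_one_coord; apply/sep/in_torus_one_coord.
Qed.

(** Distinct Laurent monomials are linearly independent over an algebraically
    closed field; this replaces every comparison of coefficients of Laurent
    polynomials below. *)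
Lemma mon_indep (k : closedFieldType) (r : nat) (I : eqType) (s : seq I) (c : I -> k)
    (w : I -> 'rV[int]_r) :
  (forall t, in_torus t -> \sum_(i <- s) c i * mon t (w i) = 0) ->
  forall chi, \sum_(i <- s | w i == chi) c i = 0.
Proof.
move=> sum0 chi.
have [/hasP[i0 _ /eqP <-]|/hasPn nochi] := boolP (has (fun i => w i == chi) s); last first.
  by rewrite big_seq_cond big1 // => i /andP[/nochi /negPf ->].
have chiM (i : I) (x y : 'rV[k]_r) : in_torus x -> in_torus y ->
    mon (tmul x y) (w i) = mon x (w i) * mon y (w i) by rewrite mon_tmul.
have chi0 (i : I) (x : 'rV[k]_r) : in_torus x -> mon x (w i) != 0 by apply: mon_neq0.
have nz1 : @in_torus k r !=set0 by exists (const_mx 1); apply: in_torus_const1.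
rewrite -[RHS](dedekind (@in_torus_tmul k r) chiM chi0 nz1 sum0 i0).
apply: eq_bigl => i; apply/eqP/asboolP => [-> //|sep].
exact: mon_sep sep.
Qed.

Lemma mpoly_torus_eq0 (k : closedFieldType) (d r : nat) (q : {mpoly k[d]})
    (w : 'X_{1..d} -> 'rV[int]_r) : injective w ->
  (forall t, in_torus t -> \sum_(a <- msupp q) q@_a * mon t (w a) = 0) -> q = 0.
Proof.
move=> w_inj sum0; apply/mpolyP => a; rewrite mcoeff0.
have [aq|/memN_msupp_eq0 //] := boolP (a \in msupp q).
rewrite -[RHS](mon_indep sum0 (w a)) (big_rem a) //= eqxx.
rewrite big_seq_cond big1 ?addr0 // => b /andP[].
rewrite (rem_filter _ (msupp_uniq q)) mem_filter /= => /andP[/negPf nb _].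
by rewrite (inj_eq w_inj) nb.
Qed.

(** * Toric varieties and their binomial equations *)

Section ToricSets.
Variables (k : fieldType) (r N : nat) (u : 'I_N -> 'rV[int]_r).
Implicit Types (a b : 'X_{1..N}) (x : 'rV[k]_N) (t : 'rV[k]_r).

Definition pt t : 'rV[k]_N := \row_i mon t (u i).
Definition pts : set 'rV[k]_N := [set pt t | t in in_torus].
Definition toric : set 'rV[k]_N := zclosure pts.

Definition wt a : 'rV[int]_r := \sum_i u i *+ a i.
Definition xm x a : k := \prod_i x 0 i ^+ a i.

Lemma wtD a b : wt (a + b) = wt a + wt b.
Proof.
by rewrite /wt -big_split /=; apply: eq_bigr => i _; rewrite mnmDE mulrnDr.
Qed.

Lemma wt0 : wt 0%MM = 0.
Proof. by rewrite /wt big1 // => i _; rewrite mnm0E. Qed.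

Lemma wtU i : wt U_(i)%MM = u i.
Proof.
rewrite /wt (bigD1 i) //= big1 ?addr0; first by rewrite mnm1E eqxx.
by move=> j /negPf nj; rewrite mnm1E eq_sym nj.
Qed.

Lemma wtMn a d : wt (a *+ d) = wt a *+ d.
Proof. by elim: d => [|d IHd]; rewrite ?mulm0n ?wt0 // mulmS wtD IHd mulrS. Qed.

Lemma xmD x a b : xm x (a + b) = xm x a * xm x b.
Proof.
by rewrite /xm -big_split /=; apply: eq_bigr => i _; rewrite mnmDE exprD.
Qed.

Lemma xm0 x : xm x 0%MM = 1.
Proof. by rewrite /xm big1 // => i _; rewrite mnm0E. Qed.

Lemma xmU x i : xm x U_(i)%MM = x 0 i.
Proof.
rewrite /xm (bigD1 i) //= big1 ?mulr1; first by rewrite mnm1E eqxx.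
by move=> j /negPf nj; rewrite mnm1E eq_sym nj.
Qed.

Lemma xmMn x a d : xm x (a *+ d) = xm x a ^+ d.
Proof. by elim: d => [|d IHd]; rewrite ?mulm0n ?xm0 // mulmS xmD IHd exprS. Qed.

Lemma xmE x a : 'X_[a].@[x 0] = xm x a.
Proof. exact: mevalX. Qed.

Lemma meval_xm (f : {mpoly k[N]}) x :
  f.@[x 0] = \sum_(a <- msupp f) f@_a * xm x a.
Proof. exact: mevalE. Qed.

Lemma mderiv_xm (f : {mpoly k[N]}) x i :
  (f^`M(i)).@[x 0] = \sum_(a <- msupp f) f@_a * ((a i)%:R * xm x (a - U_(i))%MM).
Proof.
rewrite {1}[f]mpolyE (raddf_sum (mderiv i)) (raddf_sum (meval _)).
by apply: eq_bigr => a _; rewrite /= mderivZ mderivX !mevalZ xmE.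
Qed.

Lemma xm_pt t a : in_torus t -> xm (pt t) a = mon t (wt a).
Proof.
by move=> nt; rewrite /xm /wt mon_sum //; apply: eq_bigr => i _; rewrite mxE monMn.
Qed.

Lemma pt_neq0 t (i : 'I_N) : in_torus t -> pt t != 0.
Proof.
move=> nt; apply/eqP => /rowP/(_ i)/eqP.
by rewrite !mxE (negPf (mon_neq0 _ nt)).
Qed.

Lemma pts_toric (i : 'I_N) : pts `<=` toric.
Proof. by apply: sub_zclosure => _ [t nt <-]; apply: pt_neq0. Qed.

(** The binomial equations of a toric variety. They are used at every point of
    the closure, in particular on its boundary, where some coordinates vanish. *)
Lemma toric_binomial x a b : toric x -> mdeg a = mdeg b -> wt a = wt b ->
  xm x a = xm x b.
Proof.
move=> /zclosureP[_ Hx] degab wtab.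
have homab : ('X_[a] - 'X_[b] : {mpoly k[N]}) \is (mdeg b).-homog.
  by rewrite rpredB // dhomogX; apply/eqP.
have /(Hx _ _ homab) : forall y, pts y -> ('X_[a] - 'X_[b] : {mpoly k[N]}).@[y 0] = 0.
  by move=> _ [t nt <-]; rewrite mevalB !xmE !xm_pt // wtab subrr.
by rewrite mevalB !xmE => /eqP; rewrite subr_eq0 => /eqP.
Qed.

(** [z] is the value at [x] of a Laurent monomial of degree 0 and weight [delta]
    which is regular and invertible at [x]. On the toric variety [z] is
    determined by [delta] ([laurent_val_fun]), and [delta] ranges over a
    subgroup: this is the character group of the torus orbit of [x], presented
    without faces of polytopes. *)
Definition laurent_val x (delta : 'rV[int]_r) (z : k) : Prop :=
  exists a b, [/\ mdeg a = mdeg b, xm x a != 0, xm x b != 0,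
                  wt a = wt b + delta & xm x a = z * xm x b].

Lemma laurent_val0 x : laurent_val x 0 1.
Proof.
by exists 0%MM, 0%MM; rewrite !xm0 addr0 mul1r oner_neq0.
Qed.

Lemma laurent_valD x d1 d2 z1 z2 : laurent_val x d1 z1 -> laurent_val x d2 z2 ->
  laurent_val x (d1 + d2) (z1 * z2).
Proof.
move=> [a1 [b1 [e1 na1 nb1 w1 z1E]]] [a2 [b2 [e2 na2 nb2 w2 z2E]]].
exists (a1 + a2)%MM, (b1 + b2)%MM; rewrite !mdegD !xmD !wtD !mulf_neq0 // e1 e2.
by split=> //; [rewrite w1 w2 addrACA|rewrite z1E z2E mulrACA].
Qed.

Lemma laurent_val_neq0 x d z : laurent_val x d z -> z != 0.
Proof.
move=> [a [b [_ na _ _ zE]]]; apply: contraNneq na => z0.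
by rewrite zE z0 mul0r.
Qed.

Lemma laurent_valN x d z : laurent_val x d z -> laurent_val x (- d) z^-1.
Proof.
move=> H; have z0 := laurent_val_neq0 H.
case: H => a [b [e na nb w zE]].
by exists b, a; split=> //; [rewrite w addrK|rewrite zE mulKf].
Qed.

Lemma laurent_valMn x d z l : laurent_val x d z -> laurent_val x (d *+ l) (z ^+ l).
Proof.
move=> H; elim: l => [|l IHl]; first exact: laurent_val0.
by rewrite mulrS exprS; apply: laurent_valD.
Qed.

Lemma laurent_valMz x d z (l : int) : laurent_val x d z -> laurent_val x (d *~ l) (z ^ l).
Proof.
move=> H; case: l => l; first exact: laurent_valMn.
by rewrite NegzE mulrNz; apply/laurent_valN/laurent_valMn.
Qed.

Lemma laurent_val_sum x (I : Type) (s : seq I) (D : I -> 'rV[int]_r) (z : I -> k) :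
  (forall i, laurent_val x (D i) (z i)) ->
  laurent_val x (\sum_(i <- s) D i) (\prod_(i <- s) z i).
Proof.
move=> H; elim/big_rec2: _ => [|i d e _ He]; first exact: laurent_val0.
exact: laurent_valD.
Qed.

Lemma laurent_val_xm x d z a b : toric x -> laurent_val x d z -> mdeg a = mdeg b ->
  wt a = wt b + d -> xm x a = z * xm x b.
Proof.
move=> tx [a' [b' [e na nb w zE]]] ab wab.
apply: (mulIf nb); rewrite -mulrA [xm x b * _]mulrC mulrA -zE -!xmD.
apply: toric_binomial => //; first by rewrite !mdegD ab e addnC.
by rewrite !wtD w wab addrAC [RHS]addrC addrA.
Qed.

Lemma laurent_val_fun x d z z' : toric x -> laurent_val x d z -> laurent_val x d z' -> z = z'.
Proof.
move=> tx H [a [b [e na nb w zE]]].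
by apply: (mulIf nb); rewrite -zE (laurent_val_xm tx H e w).
Qed.

Lemma laurent_val_coord x (i j : 'I_N) z : x 0 i != 0 -> x 0 j != 0 ->
  x 0 i = z * x 0 j -> laurent_val x (u i - u j) z.
Proof.
move=> xi xj xij; exists U_(i)%MM, U_(j)%MM.
by split; rewrite ?mdeg1 ?xmU ?wtU // addrC subrK.
Qed.

End ToricSets.

Section WeightParts.
Variables (k : closedFieldType) (r N : nat) (u : 'I_N -> 'rV[int]_r).
Implicit Types (f : {mpoly k[N]}).

(** The ideal of a toric variety is graded by the weights: a polynomial
    vanishes on the torus exactly when the coefficients of each weight sum to 0,
    hence its weight components vanish as well ([wpart_pts]). *)
Lemma pts_wt_sum f : (forall x, pts u x -> f.@[x 0] = 0) ->
  forall chi, \sum_(a <- msupp f | wt u a == chi) f@_a = 0.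
Proof.
move=> f0; apply: mon_indep => t nt.
rewrite -[RHS](f0 (pt u t)); last by exists t.
by rewrite meval_xm; apply: eq_bigr => a _; rewrite xm_pt.
Qed.

Definition wpart f chi : {mpoly k[N]} :=
  \sum_(a <- msupp f | wt u a == chi) f@_a *: 'X_[a].

Lemma wpart_dhomog f d chi : f \is d.-homog -> wpart f chi \is d.-homog.
Proof.
move=> /dhomogP fd; rewrite /wpart big_seq_cond.
apply: rpred_sum => a /andP[/fd ad _]; rewrite rpredZ // dhomogX.
exact/eqP.
Qed.

Lemma wpart_pts f chi : (forall x, pts u x -> f.@[x 0] = 0) ->
  forall x, pts u x -> (wpart f chi).@[x 0] = 0.
Proof.
move=> f0 _ [t nt <-]; rewrite /wpart raddf_sum /=.
rewrite (eq_bigr (fun a => f@_a * mon t chi)).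
  by rewrite -mulr_suml (pts_wt_sum f0) mul0r.
by move=> a /eqP wa; rewrite mevalZ xmE xm_pt // wa.
Qed.

Lemma sum_wpart f : f = \sum_(chi <- undup (map (wt u) (msupp f))) wpart f chi.
Proof.
rewrite {1}[f]mpolyE /wpart.
under [RHS]eq_bigr => chi _ do rewrite big_mkcond /=.
rewrite exchange_big /= big_seq [RHS]big_seq; apply: eq_bigr => a fa.
rewrite -big_mkcond /= -big_filter.
have -> : [seq i <- undup (map (wt u) (msupp f)) | wt u a == i] = [:: wt u a].
  rewrite -(filter_pred1_uniq (undup_uniq (map (wt u) (msupp f)))).
    by apply: eq_filter => i /=; rewrite eq_sym.
  by rewrite mem_undup; apply: map_f.
by rewrite big_seq1.
Qed.

Lemma mderiv_wpart f chi (x : 'rV[k]_N) i : ((wpart f chi)^`M(i)).@[x 0] =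
  \sum_(a <- msupp f | wt u a == chi) f@_a * ((a i)%:R * xm x (a - U_(i))%MM).
Proof.
rewrite /wpart (raddf_sum (mderiv i)) (raddf_sum (meval _)).
by apply: eq_bigr => a _; rewrite /= mderivZ mderivX !mevalZ xmE.
Qed.

End WeightParts.

(** * Linear systems of corank one *)

Section LinearAlgebra.
Variable k : fieldType.

Lemma row_free_col_mx s m (v : 'rV[k]_m) (M : 'M[k]_(s, m)) :
  row_free M -> ~~ (v <= M)%MS -> row_free (col_mx v M).
Proof.
move=> freeM nvM; apply: inj_row_free => x.
rewrite -[x]hsubmxK mul_row_col.
set a := lsubmx x; set b := rsubmx x.
rewrite [a]mx11_scalar mul_scalar_mx => /eqP; rewrite addr_eq0 => /eqP e.
have a0 : a 0 0 = 0.
  apply: contraNeq nvM => na; rewrite -[v](scalerK na) e scalerN -scaleNr.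
  by rewrite scalemx_sub // submxMl.
move: e; rewrite a0 scale0r => /esym/eqP; rewrite oppr_eq0 => /eqP bM.
have -> : b = 0 by apply: (row_free_inj freeM); rewrite bM mul0mx.
by rewrite raddf0 row_mx0.
Qed.

Lemma exists_maximal_free m (G : set 'rV[k]_m) :
  exists s (M : 'M[k]_(s, m)), [/\ row_free M, forall i, G (row i M) &
    forall v, G v -> (v <= M)%MS].
Proof.
pose P s := `[< exists M : 'M[k]_(s, m), row_free M /\ forall i, G (row i M) >].
have exP : exists s, P s.
  exists 0%N; apply/asboolP; exists 0; split; last by case.
  by rewrite /row_free mxrank0.
have ubP s : P s -> (s <= m)%N.
  by move=> /asboolP[M [freeM _]]; have := rank_leq_col M; rewrite (eqP freeM).
case: (ex_maxnP exP ubP) => s /asboolP[M [freeM GM]] maxs.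
exists s, M; split=> // v Gv; apply: contrapT => /negP nvM.
suff /maxs : P s.+1 by rewrite ltnn.
apply/asboolP; exists (col_mx v M); split; first exact: row_free_col_mx.
suff rowG (i : 'I_(1 + s)) : G (row i (col_mx v M)) by exact: rowG.
case: (splitP i) => j ij.
  have -> : i = lshift s j by apply: val_inj.
  by rewrite rowKu row_id.
have -> : i = rshift 1 j by apply: val_inj.
by rewrite rowKd.
Qed.

End LinearAlgebra.

Section Minors.
Variables (k : fieldType) (N : nat).

Lemma det_dhomog s (M : 'M[{mpoly k[N]}]_s) (D : 'I_s -> nat) :
  (forall i j, M i j \is (D i).-homog) -> \det M \is (\sum_i D i)%N.-homog.
Proof.
move=> hM; rewrite /determinant; apply: rpred_sum => sg _.
rewrite mulr_sign; case: ifP => _; rewrite ?rpredN.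
all: elim/big_rec2: _ => [|i d q _ Hq]; [exact: dhomog1|exact: dhomogM].
Qed.

(** The signed maximal minors of an [s] by [s + 1] matrix are polynomial in its
    entries, and give the direction of its kernel wherever this kernel is a
    line. This formula stands in for the continuity of the Gauss map. Where
    the rank drops the minors vanish, so they are still proportional to every
    vector of the kernel. *)
Lemma exists_minors s m (P : 'M[{mpoly k[N]}]_(s, m)) (D : 'I_s -> nat) :
  m = s.+1 -> (forall i j, P i j \is (D i).-homog) ->
  exists Delta : 'I_m -> {mpoly k[N]},
    [/\ forall j, Delta j \is (\sum_i D i)%N.-homog,
        forall (x : 'rV[k]_N) (w : 'rV[k]_m),
          (forall i, \sum_j (P i j).@[x 0] * w 0 j = 0) ->
          forall j j', w 0 j * (Delta j').@[x 0] = w 0 j' * (Delta j).@[x 0]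
      & forall x : 'rV[k]_N, row_free (map_mx (meval (x 0)) P) ->
          exists j, (Delta j).@[x 0] != 0].
Proof.
move=> ms; subst m => hP.
pose Delta j := cofactor (col_mx (0 : 'rV_s.+1) P : 'M_(1 + s)) ord0 j.
have rowP' (R : ringType) (v : 'rV[R]_s.+1) (P' : 'M[R]_(s, s.+1)) j :
    row' ord0 (col' j (col_mx v P' : 'M_(1 + s))) = col' j P'.
  apply/matrixP => i l; rewrite !mxE.
  have -> : lift ord0 i = rshift 1 i :> 'I_(1 + s) by apply: val_inj.
  by rewrite -[split _]/(split (unsplit (inr i))) unsplitK.
have evalE (x : 'rV[k]_N) (v : 'rV[k]_s.+1) :
    \det (col_mx v (map_mx (meval (x 0)) P) : 'M_(1 + s)) =
    \sum_j v 0 j * (Delta j).@[x 0].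
  rewrite (expand_det_row _ (ord0 : 'I_(1 + s))); apply: eq_bigr => j _.
  congr (_ * _).
    have -> : ord0 = lshift s ord0 :> 'I_(1 + s) by apply: val_inj.
    by rewrite col_mxEu.
  rewrite /Delta /cofactor !rowP' rmorphM rmorphXn rmorphN1 -det_map_mx.
  by rewrite map_col'.
exists Delta; split.
- move=> j; rewrite /Delta /cofactor rowP' -signr_odd mulr_sign.
  by case: ifP => _; rewrite ?rpredN; apply: det_dhomog => i l; rewrite mxE.
- move=> x w Pw j j'; have [w0|w0] := eqVneq w 0.
    have wz l : w 0 l = 0 by rewrite w0 mxE.
    by rewrite (wz j) (wz j') [LHS]mul0r [RHS]mul0r.
  pose v : 'rV[k]_s.+1 := w 0 j *: delta_mx 0 j' - w 0 j' *: delta_mx 0 j.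
  have sumv (F : 'I_s.+1 -> k) : \sum_l v 0 l * F l = w 0 j * F j' - w 0 j' * F j.
    have sumd (l0 : 'I_s.+1) (a : k) :
        \sum_l (a *: (delta_mx 0 l0 : 'rV_s.+1)) 0 l * F l = a * F l0.
      rewrite (bigD1 l0) //= big1 ?addr0; first by rewrite !mxE !eqxx mulr1.
      by move=> l /negPf nl; rewrite !mxE nl andbF mulr0 mul0r.
    rewrite -!sumd -sumrB; apply: eq_bigr => l _.
    by rewrite -mulrBl; congr (_ * _); rewrite /v !mxE.
  apply/eqP; rewrite -subr_eq0 -(sumv (fun l => (Delta l).@[x 0])) -evalE.
  rewrite -det_tr; apply/det0P; exists w => //.
  rewrite tr_col_mx -[RHS]row_mx0; apply/rowP => l.
  case: (splitP l) => i il.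
    have -> : l = lshift s i by apply: val_inj.
    rewrite mul_mx_row !row_mxEl !mxE.
    rewrite (eq_bigr (fun l => v 0 l * w 0 l)); last by move=> l' _; rewrite mxE ord1 mulrC.
    by rewrite sumv mulrC subrr.
  have -> : l = rshift 1 i by apply: val_inj.
  rewrite mul_mx_row !row_mxEr !mxE -[RHS](Pw i); apply: eq_bigr => l' _.
  by rewrite !mxE mulrC.
- move=> x freeP; apply: contrapT => nex.
  have full : (1%:M <= map_mx (meval (x 0)) P)%MS.
    apply/row_subP => i; apply: contrapT => /negP nle.
    have := row_free_col_mx freeP nle; rewrite (@row_free_unit _ (1 + s)) unitmxE.
    rewrite evalE big1 ?unitr0 // => j _.
    have [->|in_torus] := eqVneq (Delta j).@[x 0] 0; first by rewrite mulr0.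
    by case: nex; exists j.
  have := mxrankS full; rewrite mxrank1 => /leq_trans/(_ (rank_leq_row _)).
  by rewrite ltnn.
Qed.

End Minors.

(** * Dimension of a toric variety *)

Section Dimension.
Variables (k : closedFieldType) (r N : nat) (u : 'I_N -> 'rV[int]_r).

(** A counting argument: there are [D ^ (r + 1)] monomials of degree less than
    [D] in each of [r + 1] functions, whereas, after clearing denominators,
    they are combinations of characters of [k*^r] in a box of side
    [O(D)]. For [D] large there are fewer characters than monomials, so some
    combination of the monomials vanishes. *)
Lemma not_alg_indep_toric : ~ alg_indep_functions (@toric k r N u) r.+1.
Proof.
move=> [e [f [g [fe ge indep]]]].
have [U boundU] : exists U : nat, forall a l, `|wt u a 0 l| <= (mdeg a * U)%:Z.
  pose U := (\max_(i < N) \max_(l < r) `|u i 0%R l|)%N; exists U => a l.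
  rewrite /wt summxE mdegE big_distrl /=.
  elim/big_rec2: _ => [|i x y _ IH]; first by rewrite Num.Theory.normr0.
  apply: Order.POrderTheory.le_trans (Num.Theory.ler_normD _ _) _.
  rewrite PoszD; refine (Num.Theory.lerD _ IH).
  rewrite mulmxnE Num.Theory.normrMn -mulr_natl natz -abszE -PoszM lez_nat leq_mul2l.
  apply/orP; right.
  have le1 := leq_bigmax (F := fun l => `|u i 0%R l|%N) l.
  apply: (leq_trans le1).
  exact: (leq_bigmax (F := fun i => \max_(l < r) `|u i 0%R l|%N) i).
(* The characters in question have coordinates at most L in absolute value,
   and (2 L + 1) ^ r <= (K D) ^ r < D ^ (r + 1). *)
pose K := (2 * (r.+1 * e * U)).+1.
pose D := (K ^ r).+1.
pose L := (r.+1 * D * e * U)%N.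
pose I := {ffun 'I_r.+1 -> 'I_D}.
pose Box := {ffun 'I_r -> 'I_(2 * L).+1}.
pose vec (b : Box) : 'rV[int]_r := \row_l ((b l)%:Z - L%:Z).
pose P (phi : I) : {mpoly k[N]} := \prod_i (f i ^+ phi i * g ^+ (D - phi i)).
have Pd phi : P phi \is (r.+1 * D * e).-homog.
  have -> : (r.+1 * D * e = \sum_(i < r.+1) D * e)%N by rewrite sum_nat_const card_ord mulnA.
  rewrite /P; elim/big_rec2: _ => [|i d q _ Hq]; first exact: dhomog1.
  apply: dhomogM => //.
  have -> : (D * e = e * phi i + e * (D - phi i))%N.
    by rewrite -mulnDr subnKC 1?ltnW // mulnC.
  by apply: dhomogM; apply: dhomogMn.
pose M : 'M[k]_(#|{: I}|, #|{: Box}|) := \matrix_(i, j)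
   \sum_(a <- msupp (P (enum_val i)) | wt u a == vec (enum_val j)) (P (enum_val i))@_a.
have [c c0 cM] : exists2 c : 'rV_#|{: I}|, c != 0 & c *m M = 0.
  have lt : (#|{: Box}| < #|{: I}|)%N.
    rewrite !card_ffun !card_ord.
    apply: (@leq_ltn_trans ((K * D) ^ r)).
      have expW a b d : (a <= b -> a ^ d <= b ^ d)%N.
        by move=> ab; elim: d => // d IHd; rewrite !expnS leq_mul.
      apply: expW.
      have -> : (2 * L = 2 * (r.+1 * e * U) * D)%N.
        by rewrite /L -!mulnA; congr (_ * (_ * _))%N; rewrite mulnC -mulnA.
      by rewrite [(K * D)%N]mulSn -[ltnLHS]add0n ltn_add2r.
    by rewrite expnMn expnS ltn_pmul2r ?expn_gt0.
  have : kermx M != 0.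
    rewrite -mxrank_eq0 mxrank_ker -lt0n subn_gt0.
    exact: leq_ltn_trans (rank_leq_col _) lt.
  move=> in_torus; exists (nz_row (kermx M)); first by rewrite nz_row_eq0.
  by apply/sub_kermxP/nz_row_sub.
pose mn (phi : I) : 'X_{1..r.+1} := [multinom (phi i : nat) | i < r.+1].
pose q : {mpoly k[r.+1]} := \sum_(i < #|{: I}|) c 0 i *: 'X_[mn (enum_val i)].
have q0 : q != 0.
  have [i ci] : exists i, c 0 i != 0 by apply/rV0Pn.
  apply/eqP => /(congr1 (mcoeff (mn (enum_val i)))).
  rewrite mcoeff0 /q (raddf_sum (mcoeff _)) /= (bigD1 i) //= big1 ?addr0.
    by rewrite mcoeffZ mcoeffX eqxx mulr1; apply/eqP.
  move=> j nj; rewrite mcoeffZ mcoeffX.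
  have [/mnmP eqm|_] := eqVneq; last by rewrite mulr0.
  case/eqP: nj; apply: enum_val_inj; apply/ffunP => l; apply: val_inj.
  by have := eqm l; rewrite !mnmE.
move/eqP: q0; apply; apply: indep => x Xx gx.
pose G := \sum_(i < #|{: I}|) c 0 i *: P (enum_val i).
have Gx : G.@[x 0] = 0.
  have Gd : G \is (r.+1 * D * e).-homog by apply: rpred_sum => i _; rewrite rpredZ.
  apply: zclosure_homog Gd _ _ Xx => _ [t nt <-].
  rewrite /G (raddf_sum (meval _)) /=.
  have PE phi : (P phi).@[pt u t 0] = \sum_(b : Box)
      (\sum_(a <- msupp (P phi) | wt u a == vec b) (P phi)@_a) * mon t (vec b).
    rewrite meval_xm; under [RHS]eq_bigr => b _ do rewrite mulr_suml big_mkcond.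
    rewrite exchange_big /= big_seq [RHS]big_seq; apply: eq_bigr => a Pa.
    have da : mdeg a = (r.+1 * D * e)%N by have /dhomogP/(_ a Pa) := Pd phi.
    have bnd l : `|wt u a 0 l| <= L%:Z by rewrite /L -da.
    pose b0 : Box := [ffun l => inord (absz (wt u a 0 l + L%:Z))].
    have vec0 : vec b0 = wt u a.
      apply/rowP => l; rewrite mxE ffunE.
      have := bnd l; rewrite Num.Theory.ler_norml => /andP[lo hi].
      have ge0 : 0 <= wt u a 0 l + L%:Z by rewrite -[L%:Z]opprK Num.Theory.subr_ge0.
      rewrite inordK; first by rewrite gez0_abs // addrK.
      rewrite ltnS -lez_nat gez0_abs // mul2n -addnn PoszD.
      by rewrite Num.Theory.lerD2r.
    rewrite -big_mkcond /= (big_pred1 b0) => [|b].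
      by rewrite vec0 xm_pt.
    rewrite -vec0; apply/eqP/eqP => [|-> //] /rowP eqv.
    apply/ffunP => l; apply/val_inj; have := eqv l; rewrite !mxE.
    by move=> /addIr [].
  transitivity (\sum_(j < #|{: Box}|) (c *m M) 0 j * mon t (vec (enum_val j))).
    under eq_bigr => i _ do rewrite mevalZ PE mulr_sumr.
    rewrite (eq_bigr (fun i => \sum_(j < #|{: Box}|)
      c 0 i * M i j * mon t (vec (enum_val j)))); last first.
      move=> i _; rewrite (reindex (@enum_val _ {: Box})) /=.
        by apply: eq_bigr => j _; rewrite mxE mulrA.
      by apply: onW_bij; apply: enum_val_bij.
    rewrite exchange_big; apply: eq_bigr => j _.
    by rewrite mxE mulr_suml.
  by rewrite cM big1 // => j _; rewrite mxE mul0r.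
have -> : q.@[fun i => (f i).@[x 0] / g.@[x 0]] = G.@[x 0] / g.@[x 0] ^+ (r.+1 * D).
  rewrite /q /G !(raddf_sum (meval _)) mulr_suml; apply: eq_bigr => i _ /=.
  rewrite !mevalZ mevalX -mulrA; congr (_ * _).
  have -> : (r.+1 * D = \sum_(i < r.+1) D)%N by rewrite sum_nat_const card_ord.
  rewrite /P rmorph_prod -prodrXr -prodf_div.
  apply: eq_bigr => l _; rewrite mnmE rmorphM !rmorphXn /= expr_div_n.
  have le : (enum_val i l <= D)%N by rewrite ltnW.
  have gD : g.@[x 0] ^+ D = g.@[x 0] ^+ enum_val i l * g.@[x 0] ^+ (D - enum_val i l).
    by rewrite -exprD subnKC.
  rewrite [X in _ = _ / X]gD -[LHS]mulr1.
  by rewrite -(divff (expf_neq0 (D - enum_val i l) gx)) mulf_div.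
by rewrite Gx mul0r.
Qed.

End Dimension.

(** * Tangent spaces of the toric variety with p-divisible exponents *)

Section Derivatives.
Variables (k : fieldType) (N : nat).
Implicit Types (f : {mpoly k[N]}).

Lemma mderiv_dhomog f d i : f \is d.-homog -> f^`M(i) \is d.-1.-homog.
Proof.
move=> /dhomogP fd; rewrite [f]mpolyE (raddf_sum (mderiv i)) big_seq.
apply: rpred_sum => a /fd ad /=; have {}ad : mdeg a = d by [].
rewrite mderivZ mderivX; apply: rpredZ.
have [->|ai] := eqVneq (a i) 0%N; first by rewrite scale0r rpred0.
rewrite rpredZ // dhomogX; apply/eqP; rewrite /= -ad.
have {2}<- : ((a - U_(i)) + U_(i))%MM = a.
  by rewrite submK //; apply/mnm_lepP => j; rewrite mnm1E; case: eqP => // <-; rewrite lt0n.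
by rewrite mdegD mdeg1 addn1.
Qed.

Lemma mderiv_mulx f (x : 'rV[k]_N) i :
  (f^`M(i)).@[x 0] * x 0 i = \sum_(a <- msupp f) f@_a * ((a i)%:R * xm x a).
Proof.
rewrite mderiv_xm mulr_suml; apply: eq_bigr => a _; rewrite -!mulrA; congr (_ * _).
have [->|ai] := eqVneq (a i) 0%N; first by rewrite !mul0r.
rewrite -xmU -xmD submK //.
by apply/mnm_lepP => j; rewrite mnm1E; case: eqP => // <-; rewrite lt0n.
Qed.

Lemma euler f d (x : 'rV[k]_N) : f \is d.-homog ->
  \sum_i (f^`M(i)).@[x 0] * x 0 i = d%:R * f.@[x 0].
Proof.
move=> /dhomogP fd; under eq_bigr => i _ do rewrite mderiv_mulx.
rewrite exchange_big /= meval_xm mulr_sumr big_seq [RHS]big_seq.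
apply: eq_bigr => a /fd ad; have <- : mdeg a = d by [].
rewrite -mulr_sumr mulrCA; congr (_ * _).
by rewrite -mulr_suml mdegE natr_sum.
Qed.

End Derivatives.

Lemma expp_inj (k : fieldType) (p : nat) (char_k : p \in [pchar k]) (x y : k) :
  x ^+ p = y ^+ p -> x = y.
Proof. by rewrite -!(pFrobenius_autE char_k); apply: fmorph_inj. Qed.

Section Geometry.
Variables (k : closedFieldType) (p : nat) (char_k : p \in [pchar k]).
Variables (n m : nat) (Q : 'M[int]_n) (gam : 'I_m -> 'rV[int]_n) (j0 : 'I_m).
Hypotheses (unitQ : Q \in unitmx) (gam0 : gam j0 = 0).

Definition expo_y (j : 'I_m) : 'rV[int]_n := gam j *+ p.

Definition expo_xy (i : 'I_(n + m)) : 'rV[int]_n :=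
  match split i with inl i => row i Q | inr j => expo_y j end.

Local Notation X := (@toric k n (n + m) expo_xy).
Local Notation ls := (@lshift n m).
Local Notation rs := (@rshift n m).

Lemma expo_xyL i : expo_xy (ls i) = row i Q.
Proof. by rewrite /expo_xy -[split _]/(split (unsplit (inl i))) unsplitK. Qed.

Lemma expo_xyR j : expo_xy (rs j) = expo_y j.
Proof. by rewrite /expo_xy -[split _]/(split (unsplit (inr j))) unsplitK. Qed.

Lemma expo_y0 : expo_y j0 = 0. Proof. by rewrite /expo_y gam0 mul0rn. Qed.

Lemma natr_p_eq0 : p%:R = 0 :> k.
Proof. by apply/eqP; case/andP: char_k. Qed.

Lemma toric_idealP (f : {mpoly k[n + m]}) : homog_ideal X f <->
  (exists d, f \is d.-homog) /\ forall x, pts expo_xy x -> f.@[x 0] = 0.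
Proof.
split=> [[[d fd] Xf]|[[d fd] f0]]; split; try by exists d.
  by move=> x Hx; apply: Xf; apply: pts_toric Hx; apply: rs j0.
by move=> x; apply: zclosure_homog fd f0 _.
Qed.

(** The coordinates of a weight on the basis of rows of [Q], reduced modulo [p].
    Since the exponents of the [y_j] are divisible by [p], these coordinates
    are the exponents of [x_1, ..., x_n] modulo [p] ([expo_mod_wt]). *)
Definition expo_mod (i : 'I_n) (chi : 'rV[int]_n) : k := ((chi *m invmx Q) 0 i)%:~R.

Lemma expo_modD i : {morph expo_mod i : x y / x + y}.
Proof. by move=> x y; rewrite /expo_mod mulmxDl mxE rmorphD. Qed.

Lemma expo_mod0 i : expo_mod i 0 = 0.
Proof. by rewrite /expo_mod mul0mx mxE. Qed.

Lemma expo_modMn i c : {morph expo_mod i : x / x *+ c}.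
Proof.
move=> x; elim: c => [|c IHc]; first by rewrite !mulr0n expo_mod0.
by rewrite !mulrS expo_modD IHc.
Qed.

Lemma expo_mod_wt i a : expo_mod i (wt expo_xy a) = (a (ls i))%:R.
Proof.
rewrite /wt (big_morph _ (@expo_modD i) (@expo_mod0 i)) big_split_ord /=.
rewrite [X in _ + X]big1 ?addr0; last first.
  move=> j _; rewrite expo_xyR expo_modMn /expo_y expo_modMn.
  by rewrite -[_ *+ p]mulr_natr natr_p_eq0 mulr0 mul0rn.
rewrite (bigD1 i) //= big1 ?addr0 => [|l /negPf nl]; rewrite expo_xyL expo_modMn.
  by rewrite /expo_mod -row_mul mulmxV // !mxE eqxx.
by rewrite /expo_mod -row_mul mulmxV // !mxE nl mul0rn.
Qed.

Lemma sum_wt_fun (s : seq 'X_{1..n + m}) (c : 'X_{1..n + m} -> k)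
    (phi : 'rV[int]_n -> k) :
  (forall chi, \sum_(a <- s | wt expo_xy a == chi) c a = 0) ->
  \sum_(a <- s) c a * phi (wt expo_xy a) = 0.
Proof.
move=> c0.
apply: (@sum_over_classes _ _ (fun a b => wt expo_xy a == wt expo_xy b) s c
  (fun a => phi (wt expo_xy a))).
- by move=> a b d; split=> // /eqP ->.
- by move=> a _; apply: c0.
- by move=> a b _ _ /eqP ->.
Qed.

Lemma pts_mderiv_l f : (forall x, pts expo_xy x -> f.@[x 0] = 0) ->
  forall i x, pts expo_xy x -> (f^`M(ls i)).@[x 0] = 0 :> k.
Proof.
move=> f0 i _ [t nt <-]; apply: (@mulIf _ (pt expo_xy t 0 (ls i))).
  by rewrite mxE mon_neq0.
rewrite mderiv_mulx mul0r.
rewrite (eq_bigr (fun a => f@_a * (expo_mod i (wt expo_xy a) * mon t (wt expo_xy a)))).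
  by apply: (@sum_wt_fun _ _ (fun chi => expo_mod i chi * mon t chi)); apply: pts_wt_sum.
by move=> a _; rewrite expo_mod_wt xm_pt.
Qed.

(** On the torus, [x_i] times the derivative along [x_i] multiplies the component
    of weight [chi] of a polynomial by the constant [expo_mod i chi]; so the
    derivative along [x_i] of an equation of [X] is again an equation. Thus all
    tangent spaces contain the coordinate subspace of the [x_i], and only the
    derivatives along the [y_j] matter ([tangent_toricE]). *)
Lemma toric_mderiv_l f x i : homog_ideal X f -> X x -> (f^`M(ls i)).@[x 0] = 0.
Proof.
move=> /toric_idealP[[d fd] f0]; apply: zclosure_homog (mderiv_dhomog _ fd) _ _.
exact: pts_mderiv_l.
Qed.

Lemma tangent_toricE x v : X x -> tangent_space X x v <->
  forall f, homog_ideal X f -> \sum_j (f^`M(rs j)).@[x 0] * v 0 (rs j) = 0.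
Proof.
move=> Xx; have E f : homog_ideal X f ->
    \sum_(i < n + m) (f^`M(i)).@[x 0] * v 0 i =
    \sum_j (f^`M(rs j)).@[x 0] * v 0 (rs j).
  move=> fI; rewrite big_split_ord /= big1 ?add0r // => i _.
  by rewrite toric_mderiv_l ?mul0r.
by split=> Hv f fI; have := Hv f fI; rewrite E.
Qed.

(** The tangent spaces at smooth points are spanned by the coordinate subspace
    of the [x_i] and one vector [w] in the coordinates [y_j]. *)
Definition tangent_mx (w : 'rV[k]_m) : 'M[k]_(1 + n, n + m) := block_mx 0 w 1%:M 0.

Lemma sub_tangent_mx w v : (v <= tangent_mx w)%MS <-> exists c, rsubmx v = c *: w.
Proof.
split=> [/submxP[D ->]|[c vE]].
  exists (lsubmx D 0 0); rewrite -[D in LHS]hsubmxK mul_row_block row_mxKr.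
  by rewrite mulmx0 addr0 {1}[lsubmx D]mx11_scalar mul_scalar_mx.
apply/submxP; exists (row_mx c%:M (lsubmx v)).
rewrite mul_row_block mulmx0 mulmx1 mulmx0 add0r addr0 mul_scalar_mx -vE.
by rewrite hsubmxK.
Qed.

Lemma row_free_tangent_mx w : w != 0 -> row_free (tangent_mx w).
Proof.
move=> w0; apply: inj_row_free => v; rewrite -[v]hsubmxK mul_row_block.
rewrite !mulmx0 mulmx1 add0r addr0 -[RHS]row_mx0 => /eq_row_mx[-> ].
rewrite [lsubmx v]mx11_scalar mul_scalar_mx => /eqP.
rewrite scaler_eq0 (negPf w0) orbF => /eqP ->.
by rewrite raddf0 row_mx0.
Qed.

(** The coordinate [y_j0] has weight 0, so it can balance degrees without
    changing weights; hence every weight is a difference of two monomials of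
    the same degree. *)
Lemma exists_deg0_wt delta : exists C D : 'X_{1..n + m},
  mdeg C = mdeg D /\ wt expo_xy C = wt expo_xy D + delta.
Proof.
pose x : 'rV[k]_(n + m) := pt expo_xy (const_mx 1).
have xE i : x 0 i = 1 by rewrite mxE mon_const1.
have Hl i : laurent_val expo_xy x (row i Q) 1.
  have := @laurent_val_coord k _ _ expo_xy x (ls i) (rs j0) 1.
  rewrite !xE mulr1 expo_xyL expo_xyR expo_y0 subr0; apply=> //; exact: oner_neq0.
pose b := delta *m invmx Q.
have -> : delta = \sum_i row i Q *~ b 0 i.
  rewrite -[delta](mulmxKV unitQ) -/b mulmx_sum_row.
  by apply: eq_bigr => i _; rewrite -scaler_int intz.
have [C [D [degCD _ _ wtCD _]]] :=
  laurent_val_sum (index_enum 'I_n) (fun i => laurent_valMz (b 0 i) (Hl i)).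
by exists C, D.
Qed.

(** The Gauss map on the torus, read in the coordinates [y_j]
    ([tangent_pt]). *)
Definition gauss_pt t : 'rV[k]_m := pt expo_y t.

Lemma gauss_ptE t j : gauss_pt t 0 j = mon t (expo_y j). Proof. by rewrite mxE. Qed.

Lemma gauss_pt_j0 t : gauss_pt t 0 j0 = 1. Proof. by rewrite gauss_ptE expo_y0 mon0. Qed.

Lemma pt_rs t j : pt expo_xy t 0 (rs j) = gauss_pt t 0 j.
Proof. by rewrite !mxE expo_xyR. Qed.

Lemma pts_mderiv_gauss_pt f d t : f \is d.-homog -> (forall x, pts expo_xy x -> f.@[x 0] = 0) ->
  in_torus t -> \sum_j (f^`M(rs j)).@[pt expo_xy t 0] * gauss_pt t 0 j = 0.
Proof.
move=> fd f0 nt; have ptx : pts expo_xy (pt expo_xy t) by exists t.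
have := euler (pt expo_xy t) fd; rewrite (f0 _ ptx) mulr0 big_split_ord /= big1 ?add0r.
  by under eq_bigr => j _ do rewrite pt_rs.
by move=> i _; rewrite pts_mderiv_l ?mul0r.
Qed.

(** One inclusion is Euler's formula. For the other one, the equation
    [x ^ (p C) y_j = x ^ (p D) y_j0] has derivatives only along [y_j] and
    [y_j0], because its other exponents are multiples of [p]; it determines
    the coordinate [y_j] of a tangent vector from the coordinate [y_j0]. *)
Lemma tangent_pt t : in_torus t ->
  tangent_space X (pt expo_xy t) = [set v | (v <= tangent_mx (gauss_pt t))%MS].
Proof.
move=> nt; have ptx : pts expo_xy (pt expo_xy t) by exists t.
have Xt : X (pt expo_xy t) by apply: pts_toric ptx; apply: rs j0.
rewrite eqEsubset; split=> v; last first.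
  move=> /sub_tangent_mx[c vE]; apply/(tangent_toricE _ Xt) => f /toric_idealP[[d fd] f0].
  rewrite (eq_bigr (fun j => c * ((f^`M(rs j)).@[pt expo_xy t 0] * gauss_pt t 0 j))).
    by rewrite -mulr_sumr (pts_mderiv_gauss_pt fd f0 nt) mulr0.
  move=> j _; rewrite mulrCA; congr (_ * _).
  by have /rowP/(_ j) := vE; rewrite !mxE.
move=> /(tangent_toricE _ Xt) Hv; apply/sub_tangent_mx; exists (v 0 (rs j0)).
apply/rowP => j; have [C [D [degCD wtCD]]] := exists_deg0_wt (- gam j).
pose A := (C *+ p + U_(rs j))%MM; pose B := (D *+ p + U_(rs j0))%MM.
have degAB : mdeg A = mdeg B by rewrite !mdegD !mdegMn !mdeg1 degCD.
have wtAB : wt expo_xy A = wt expo_xy B.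
  rewrite !wtD !wtMn !wtU !expo_xyR expo_y0 addr0 wtCD mulrnDl mulNrn /expo_y.
  by rewrite subrK.
pose f : {mpoly k[n + m]} := 'X_[A] - 'X_[B].
have fI : homog_ideal X f.
  apply/toric_idealP; split=> [|_ [s ns <-]].
    by exists (mdeg B); rewrite rpredB // dhomogX; apply/eqP.
  by rewrite mevalB !xmE !xm_pt // wtAB subrr.
have der E l i : (('X_[E *+ p + U_(i)])^`M(l)).@[pt expo_xy t 0] =
    (i == l)%:R * mon t (wt expo_xy E) ^+ p.
  rewrite mderivX mevalZ xmE mnmDE mulmnE mnm1E natrD natrM natr_p_eq0 mulr0 add0r.
  have [->|_] := eqVneq i l; rewrite ?mul0r //.
  by rewrite addmK xmMn xm_pt.
have := Hv f fI.
rewrite (eq_bigr (fun l => (rs j == rs l)%:R * mon t (wt expo_xy C) ^+ p * v 0 (rs l)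
   - (rs j0 == rs l)%:R * mon t (wt expo_xy D) ^+ p * v 0 (rs l))); last first.
  by move=> l _; rewrite mderivB mevalB !der mulrBl.
rewrite sumrB (bigD1 j) //= big1 ?addr0; last first.
  by move=> l nl; rewrite (inj_eq (@rshift_inj _ _)) eq_sym (negPf nl) !mul0r.
rewrite (bigD1 j0) //= big1 ?addr0; last first.
  by move=> l nl; rewrite (inj_eq (@rshift_inj _ _)) eq_sym (negPf nl) !mul0r.
have nM := mon_neq0 (wt expo_xy D) nt; have nG := mon_neq0 (gam j) nt.
rewrite !eqxx !mul1r wtCD monB // => /eqP; rewrite subr_eq0 => /eqP e.
rewrite [LHS]mxE [RHS]mxE gauss_ptE /expo_y monMn //.
apply: (mulfI (expf_neq0 p nM)); rewrite mulrA -e exprMn exprVn.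
by rewrite -!mulrA [_^-1 * _]mulrC -mulrA divff ?mulr1 // expf_neq0.
Qed.


(** A tangent space of dimension [n + 1] contains the [n]-dimensional coordinate
    subspace of the [x_i], so it meets the coordinate subspace of the [y_j] in
    a line. *)
Lemma tangent_shape (x : 'rV[k]_(n + m)) (B : 'M[k]_(n.+1, n + m)) : X x -> row_free B ->
  [set v : 'rV[k]_(n + m) | (v <= B)%MS] = tangent_space X x ->
  exists2 w, w != 0 & tangent_space X x = [set v | (v <= tangent_mx w)%MS].
Proof.
move=> Xx freeB TB.
have TBP v : (v <= B)%MS <-> tangent_space X x v by rewrite -TB.
have T0 v : tangent_space X x v -> tangent_space X x (row_mx 0 (rsubmx v)).
  move=> /(tangent_toricE _ Xx) Hv; apply/(tangent_toricE _ Xx) => f fI.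
  by rewrite -[RHS](Hv f fI); apply: eq_bigr => j _; rewrite row_mxEr mxE.
have Tl v : tangent_space X x (row_mx v 0).
  apply/(tangent_toricE _ Xx) => f fI.
  by rewrite big1 // => j _; rewrite row_mxEr mxE mulr0.
pose L := rsubmx B.
have subL : (row_mx 0 L <= B)%MS.
  apply/row_subP => i; apply/TBP.
  have rowL : row i L = rsubmx (row i B) by apply/rowP => j; rewrite !mxE.
  by rewrite row_row_mx row0 rowL; apply: T0; apply/TBP; exact: row_sub.
pose E : 'M[k]_(n + n.+1, n + m) := block_mx 1%:M 0 0 L.
have EB : (E == B)%MS.
  apply/andP; split.
    rewrite /E -[block_mx _ _ _ _]/(col_mx (row_mx 1%:M 0) (row_mx 0 L)) col_mx_sub subL.
    rewrite andbT; apply/row_subP => i; apply/TBP; rewrite row_row_mx row0; exact: Tl.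
  apply/submxP; exists (row_mx (lsubmx B) 1%:M).
  by rewrite mul_row_block mulmx1 !mulmx0 mul1mx add0r addr0 hsubmxK.
have rkL : \rank L = 1%N.
  have := eqmx_rank EB; rewrite (eqP freeB) rank_diag_block_mx mxrank1.
  by move=> e; apply/eqP; rewrite -(eqn_add2l n) addn1; apply/eqP.
have L0 : L != 0 by rewrite -mxrank_eq0 rkL.
exists (nz_row L); first by rewrite nz_row_eq0.
have wL : (nz_row L == L)%MS.
  rewrite -(mxrank_leqif_eq (nz_row_sub L)).2 rkL rank_rV nz_row_eq0 L0 //.
rewrite eqEsubset; split=> v.
  move=> /T0 /TBP; rewrite -(eqmxP EB) => /submxP[D DE].
  have : (rsubmx v <= L)%MS.
    apply/submxP; exists (rsubmx D); have := congr1 rsubmx DE.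
    rewrite row_mxKr -[D in RHS]hsubmxK mul_row_block row_mxKr.
    by rewrite mulmx0 add0r.
  by rewrite -(eqmxP wL) => /sub_rVP[c vE]; apply/sub_tangent_mx; exists c.
move=> /sub_tangent_mx[c vE].
have -> : v = row_mx (lsubmx v) 0 + row_mx 0 (rsubmx v).
  by rewrite add_row_mx addr0 add0r hsubmxK.
apply/TBP; apply: addmx_sub; first by apply/TBP; apply: Tl.
apply: submx_trans subL.
have /submxP[D ->] : (rsubmx v <= L)%MS.
  by rewrite vE scalemx_sub // (eqmxP wL).
by apply/submxP; exists D; rewrite mul_mx_row mulmx0.
Qed.

(** Continuity of the Gauss map at a point [x] of the boundary. Choose equations
    whose gradients at [x] span the conormal space; the maximal minors [Delta]
    of their Jacobian are polynomials such that [Delta x] is proportional to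
    [w], and [Delta t] to [gauss_pt t] on the torus. An equation [f] of the
    image of the torus then gives the equation [f(Delta)] of [X], whose value
    at [x] is a nonzero multiple of [f w]. *)
Lemma gauss_closure (x : 'rV[k]_(n + m)) w : X x -> w != 0 ->
  tangent_space X x = [set v | (v <= tangent_mx w)%MS] -> toric expo_y w.
Proof.
move=> Xx w0 TE.
pose grad (f : {mpoly k[n + m]}) : 'rV[k]_m := \row_j (f^`M(rs j)).@[x 0].
have [s [M [freeM GM maxM]]] :=
  exists_maximal_free [set v | exists2 f, homog_ideal X f & v = grad f].
pose F i := projT1 (cid2 (GM i)).
have FI i : homog_ideal X (F i) by rewrite /F; case: cid2.
have rowM i : row i M = grad (F i) by rewrite /F; case: cid2.
have Fd i : exists d, F i \is d.-homog by have [] := FI i.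
pose D i := (projT1 (cid (Fd i))).-1.
have FD i j : (F i)^`M(rs j) \is (D i).-homog.
  by apply: mderiv_dhomog; rewrite /D; case: cid.
pose P : 'M[{mpoly k[n + m]}]_(s, m) := \matrix_(i, j) (F i)^`M(rs j).
have PM : map_mx (meval (x 0)) P = M.
  apply/matrixP => i j; rewrite !mxE.
  by have /rowP/(_ j) := rowM i; rewrite !mxE.
have kerE (v : 'rV[k]_m) : (v *m M^T == 0) = (v <= w)%MS.
  apply/eqP/idP => [vM|].
    have : tangent_space X x (row_mx 0 v).
      apply/(tangent_toricE _ Xx) => f fI.
      have /submxP[c fE] : (grad f <= M)%MS by apply: maxM; exists f.
      have e : v *m (grad f)^T = 0 by rewrite fE trmx_mul mulmxA vM mul0mx.
      have := congr1 (fun A : 'M_1 => A 0 0) e; rewrite !mxE => e'.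
      by rewrite -[RHS]e'; apply: eq_bigr => j _; rewrite row_mxEr !mxE mulrC.
    by rewrite TE => /sub_tangent_mx[c]; rewrite row_mxKr => ->; rewrite scalemx_sub.
  move=> /sub_rVP[c ->].
  have /(tangent_toricE _ Xx) Tw : tangent_space X x (row_mx 0 w).
    by rewrite TE; apply/sub_tangent_mx; exists 1; rewrite row_mxKr scale1r.
  rewrite -scalemxAl; apply/eqP; rewrite scaler_eq0; apply/orP; right.
  apply/eqP/rowP => i; rewrite !mxE -[RHS](Tw (F i) (FI i)).
  apply: eq_bigr => j _; rewrite row_mxEr mulrC; congr (_ * _).
  by have /rowP/(_ j) := rowM i; rewrite !mxE.
have ms : m = s.+1.
  have kerw : (kermx M^T == w)%MS.
    apply/andP; split; last by apply/sub_kermxP/eqP; rewrite kerE.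
    by apply/row_subP => i; rewrite -kerE -row_mul mulmx_ker row0.
  have := eqmx_rank kerw; rewrite mxrank_ker mxrank_tr (eqP freeM).
  rewrite rank_rV w0 => e; have {}e : (m - s)%N = 1%N by [].
  by apply/eqP; rewrite -add1n -e subnK // -(eqP freeM) rank_leq_col.
have [Delta [hDelta DeltaE Delta0]] := exists_minors ms (fun i j =>
  (etrans (congr1 (fun q => q \is (D i).-homog) (mxE _ _ i j)) (FD i j)) :
  P i j \is (D i).-homog).
apply/zclosureP; split=> // d f fd f0.
have hcomp := dhomog_comp fd hDelta.
have fDelta : f.@[fun j => (Delta j).@[x 0]] = 0.
  rewrite -meval_comp; apply: (zclosure_homog hcomp _ Xx) => _ [t nt <-].
  rewrite meval_comp; set y := pt expo_xy t.
  have kery i : \sum_j (P i j).@[y 0] * gauss_pt t 0 j = 0.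
    have [[d' Fd'] Fpts] := (toric_idealP _).1 (FI i).
    rewrite -[RHS](pts_mderiv_gauss_pt Fd' Fpts nt).
    by apply: eq_bigr => j _; rewrite mxE.
  have DE j : (Delta j).@[y 0] = ((Delta j0).@[y 0] *: gauss_pt t) 0 j.
    by rewrite mxE -[LHS]mul1r -(gauss_pt_j0 t) (DeltaE _ _ kery) mulrC.
  rewrite (meval_eq _ DE) (meval_dhomogZ _ _ fd) f0 ?mulr0 //.
  by exists t.
have [j1 nj1] : exists j, (Delta j).@[x 0] != 0 by apply: Delta0; rewrite PM.
have kerx i : \sum_j (P i j).@[x 0] * w 0 j = 0.
  have : w *m M^T == 0 by rewrite kerE.
  move=> /eqP/rowP/(_ i); rewrite !mxE => e; rewrite -[RHS]e.
  apply: eq_bigr => j _; rewrite mulrC !mxE; congr (_ * _).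
  by have /rowP/(_ j) := rowM i; rewrite !mxE.
have DE j : w 0 j = ((w 0 j1 / (Delta j1).@[x 0]) *: (\row_j (Delta j).@[x 0])) 0 j.
  by rewrite !mxE mulrAC -(DeltaE _ _ kerx j j1) mulfK.
rewrite (meval_eq _ DE) (meval_dhomogZ _ _ fd).
by rewrite (@meval_eq _ _ _ (fun j => (Delta j).@[x 0])) ?fDelta ?mulr0 // => j; rewrite mxE.
Qed.

(** Say that [j] is linked to [j1] when [y_j / y_j1] has the weight of a Laurent
    monomial invertible at [x]. The gradient at [x] of an equation that is
    homogeneous for the weights only involves linked coordinates [y_j], so the
    part of [w] supported by one class is again tangent; as the tangent
    directions in the [y_j] form a line and no coordinate of [w] vanishes,
    there is a single class. So along the fiber the quotients [y_j / y_j0] are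
    invertible Laurent monomials even at points where all [y_j] vanish. *)
Lemma gauss_laurent_val (x : 'rV[k]_(n + m)) (w : 'rV[k]_m) : X x -> (forall j, w 0 j != 0) ->
  tangent_space X x = [set v | (v <= tangent_mx w)%MS] ->
  forall j, laurent_val expo_xy x (expo_y j) (w 0 j / w 0 j0).
Proof.
move=> Xx w0 TE.
have Tw : tangent_space X x (row_mx 0 w).
  by rewrite TE; apply/sub_tangent_mx; exists 1; rewrite row_mxKr scale1r.
pose cls j := `[< exists z, laurent_val expo_xy x (expo_y j - expo_y j0) z >].
have clsE j j1 : cls j1 -> (exists z, laurent_val expo_xy x (expo_y j - expo_y j1) z) -> cls j.
  move=> /asboolP[z1 Hz1] [z Hz]; apply/asboolP; exists (z * z1).
  by rewrite -[expo_y j](subrK (expo_y j1)) -addrA; apply: laurent_valD.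
(* The restriction to the class of j0 of the gradient of a weight component is
   either the whole gradient along the y_j, or zero. *)
have part f chi : homog_ideal X f ->
    \sum_j ((wpart expo_xy f chi)^`M(rs j)).@[x 0] * (if cls j then w 0 j else 0) = 0.
  move=> /toric_idealP[[d fd] f0]; set f' := wpart _ _ _.
  have f'I : homog_ideal X f'.
    apply/toric_idealP; split; last exact: wpart_pts.
    by exists d; apply: wpart_dhomog.
  have ex j : (f'^`M(rs j)).@[x 0] != 0 -> exists a,
      [/\ mdeg a = d, wt expo_xy a = chi, (U_(rs j) <= a)%MM & xm x (a - U_(rs j))%MM != 0].
    move=> in_torus; apply: contrapT => nex; move/eqP: in_torus; apply.
    rewrite /f' mderiv_wpart big_seq_cond big1 // => a /andP[fa /eqP wa].
    have [->|aj] := eqVneq (a (rs j)) 0%N; first by rewrite mul0r mulr0.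
    have [->|xa] := eqVneq (xm x (a - U_(rs j))%MM) 0; first by rewrite !mulr0.
    case: nex; exists a; split=> //; first by have /dhomogP/(_ a fa) := fd.
    by apply/mnm_lepP => l; rewrite mnm1E; case: eqP => // <-; rewrite lt0n.
  have [/existsP[j1 /andP[c1 nz1]]|/existsPn none] :=
    boolP [exists j1, cls j1 && ((f'^`M(rs j1)).@[x 0] != 0)].
    have := (tangent_toricE _ Xx).1 Tw f' f'I => sum0.
    rewrite -[RHS]sum0; apply: eq_bigr => j _; rewrite row_mxEr.
    have [->|nzj] := eqVneq (f'^`M(rs j)).@[x 0] 0; first by rewrite !mul0r.
    suff -> : cls j by [].
    have [a [da wa la xa]] := ex _ nzj; have [a1 [da1 wa1 la1 xa1]] := ex _ nz1.
    apply: (clsE _ _ c1).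
    exists (xm x (a1 - U_(rs j1))%MM / xm x (a - U_(rs j))%MM).
    exists (a1 - U_(rs j1))%MM, (a - U_(rs j))%MM; split=> //.
    - apply/eqP; rewrite -(eqn_add2r 1) -{1}(mdeg1 (rs j1)) -(mdeg1 (rs j)) -!mdegD.
      by rewrite !submK // da da1.
    - apply: (addIr (expo_y j1)); rewrite -{1}expo_xyR -wtU -wtD submK //.
      by rewrite -addrA subrK -expo_xyR -wtU -wtD submK // wa.
    - by rewrite divfK.
  rewrite big1 // => j _; have := none j.
  case: (cls j) => /=; last by rewrite mulr0.
  by rewrite negbK => /eqP ->; rewrite mul0r.
have Tcls : tangent_space X x (row_mx 0 (\row_j if cls j then w 0 j else 0)).
  apply/(tangent_toricE _ Xx) => f fI.
  transitivity (\sum_j \sum_(chi <- undup (map (wt expo_xy) (msupp f)))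
     ((wpart expo_xy f chi)^`M(rs j)).@[x 0] * (if cls j then w 0 j else 0)).
    apply: eq_bigr => j _; rewrite row_mxEr mxE -mulr_suml; congr (_ * _).
    by rewrite {1}(sum_wpart expo_xy f) (raddf_sum (mderiv _)) (raddf_sum (meval _)).
  by rewrite exchange_big /= big1 // => chi _; apply: part.
have cls_all j : cls j.
  have cls0 : cls j0 by apply/asboolP; exists 1; rewrite subrr; apply: laurent_val0.
  move: Tcls; rewrite TE => /sub_tangent_mx[c]; rewrite row_mxKr => /rowP cE.
  have := cE j0; rewrite !mxE cls0 => e0; have := cE j; rewrite !mxE.
  case: (cls j) => // /esym/eqP; rewrite mulf_eq0 (negPf (w0 j)) orbF => /eqP c0.
  by move/eqP: e0; rewrite c0 mul0r (negPf (w0 j0)).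
have [s xE] : exists s, rsubmx x = s *: w.
  have : tangent_space X x x.
    move=> f /toric_idealP[[d fd] f0].
    by rewrite (euler _ fd) (zclosure_homog fd f0 Xx) mulr0.
  by rewrite TE => /sub_tangent_mx.
have xrs j : x 0 (rs j) = s * w 0 j by have /rowP/(_ j) := xE; rewrite !mxE.
(* If the y_j do not vanish at x, the quotients y_j / y_j0 are themselves
   invertible. Otherwise the value is read off the derivative along w of the
   binomial equation f. *)
move=> j; have [s0|ns] := eqVneq s 0; last first.
  rewrite -[expo_y j]subr0 -expo_y0 -!expo_xyR.
  apply: laurent_val_coord; rewrite !xrs ?mulf_neq0 //.
  by rewrite mulrCA divfK.
have /asboolP[z] := cls_all j; rewrite expo_y0 subr0 => Hz.
case: (Hz) => A [B [degAB nA nB wtAB zE]].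
suff -> : w 0 j / w 0 j0 = z by [].
pose f : {mpoly k[n + m]} := 'X_[A] * 'X_(rs j0) - 'X_[B] * 'X_(rs j).
have fI : homog_ideal X f.
  apply/toric_idealP; split=> [|_ [t nt <-]].
    exists (mdeg B + 1)%N; apply: rpredB; apply: dhomogM; rewrite dhomogX; apply/eqP => //;
      exact: mdeg1.
  rewrite mevalB !mevalM !xmE !xm_pt // -!monD // !wtU !expo_xyR wtAB expo_y0 addr0.
  by rewrite subrr.
have := (tangent_toricE _ Xx).1 Tw f fI.
have x0 l : x 0 (rs l) = 0 by rewrite xrs s0 mul0r.
rewrite (eq_bigr (fun l => xm x A * ((j0 == l)%:R * w 0 l) - xm x B * ((j == l)%:R * w 0 l))).
  rewrite sumrB -!mulr_sumr.
  have sumE l0 : \sum_l (l0 == l)%:R * w 0 l = w 0 l0.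
    rewrite (bigD1 l0) //= eqxx mul1r big1 ?addr0 // => l /negPf nl.
    by rewrite eq_sym nl mul0r.
  rewrite !sumE zE => /eqP; rewrite subr_eq0 => /eqP e.
  apply: (mulIf (w0 j0)); rewrite divfK //; apply: (mulfI nB); rewrite -e.
  by rewrite mulrA [z * _]mulrC.
move=> l _; rewrite row_mxEr mderivB !mderivM mevalB !mevalD !mevalM !xmE !xmU !x0.
rewrite !mulr0 !add0r !mderivX !mevalZ !mnm1E !(inj_eq (@rshift_inj _ _)).
rewrite !xmE mulrBl -!mulrA.
have U0 i : (U_(i) - U_(i) : 'X_{1..n + m})%MM = 0%MM.
  by apply/mnmP => l'; rewrite mnmBE mnm0E subnn.
congr (_ * _ - _ * _).
  by have [->|_] := eqVneq j0 l; rewrite ?mul0r // U0 xm0 mulrA mulr1.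
by have [->|_] := eqVneq j l; rewrite ?mul0r // U0 xm0 mulrA mulr1.
Qed.

(** Every point of a general fiber, including the smooth points of [X] outside the
    torus, is in the closure of the part of the fiber in the torus. An
    equation [f] of that part splits along the characters of the kernel of the
    Gauss map; within one class the [p]-th powers of two monomials differ by a
    product of characters [expo_y j], whose values at [x] are known by
    [gauss_laurent_val] to be those at [t0]. As [p]-th roots are unique, each
    class contributes 0 to [f x]. *)
Lemma fiber_closure (x : 'rV[k]_(n + m)) t0 : X x -> in_torus t0 ->
  (forall u, (forall h : 'rV[k]_n, in_torus h -> (forall j, mon h (expo_y j) = 1) -> mon h u = 1) ->
     exists beta : 'I_m -> int, u *+ p = \sum_j expo_y j *~ beta j) ->
  tangent_space X x = [set v | (v <= tangent_mx (gauss_pt t0))%MS] ->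
  zclosure [set pt expo_xy t | t in [set t | in_torus t /\ gauss_pt t = gauss_pt t0]] x.
Proof.
move=> Xx nt0 Hgam TE.
have wn0 j : gauss_pt t0 0 j != 0 by rewrite gauss_ptE mon_neq0.
have Hl j : laurent_val expo_xy x (expo_y j) (mon t0 (expo_y j)).
  by have := gauss_laurent_val Xx wn0 TE j; rewrite gauss_pt_j0 divr1 gauss_ptE.
apply/zclosureP; split=> [|d f fd f0]; first by case/zclosureP: Xx.
pose H : set 'rV[k]_n := [set h | in_torus h /\ forall j, mon h (expo_y j) = 1].
have nzH h : H h -> in_torus h by case.
have H1 : H (const_mx 1) by split=> [|j]; [exact: in_torus_const1|rewrite mon_const1].
have HM h h' : H h -> H h' -> H (tmul h h').
  move=> [nh Hh] [nh' Hh']; split=> [|j]; first exact: in_torus_tmul.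
  by rewrite mon_tmul Hh Hh' mulr1.
pose E (a b : 'X_{1..n + m}) :=
  `[< forall h, H h -> mon h (wt expo_xy a) = mon h (wt expo_xy b) >].
have sumE a0 : \sum_(a <- msupp f | E a a0) f@_a * mon t0 (wt expo_xy a) = 0.
  apply: (dedekind (chi := fun a h => mon h (wt expo_xy a)) HM).
  - by move=> a h h' Hh Hh'; rewrite mon_tmul.
  - by move=> a h /nzH nh; apply: mon_neq0.
  - by exists (const_mx 1).
  move=> h [nh Hh]; rewrite -[RHS](f0 (pt expo_xy (tmul t0 h))).
    rewrite meval_xm; apply: eq_bigr => a _.
    by rewrite xm_pt ?mon_tmul -?mulrA //; apply: in_torus_tmul.
  exists (tmul t0 h) => //; split; first exact: in_torus_tmul.
  by apply/rowP => j; rewrite !gauss_ptE mon_tmul Hh mulr1.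
(* phi is constant on the classes, which reduces f x to the class sums. *)
pose phi a := xm x a / mon t0 (wt expo_xy a).
rewrite meval_xm (eq_bigr (fun a => (f@_a * mon t0 (wt expo_xy a)) * phi a)); last first.
  by move=> a _; rewrite /phi -mulrA [mon _ _ * _]mulrC divfK ?mon_neq0.
apply: (@sum_over_classes _ _ E) => [a b c|a _|a b fa fb /asboolP Eab].
- split; first by apply/asboolP.
  move=> /asboolP ab; apply/asboolP/asboolP => Hc h Hh; first by rewrite -ab // Hc.
  by rewrite ab // Hc.
- exact: sumE.
have /Hgam[beta betaE] : forall h : 'rV[k]_n, in_torus h -> (forall j, mon h (expo_y j) = 1) ->
    mon h (wt expo_xy a - wt expo_xy b) = 1.
  by move=> h nh Hh; rewrite monB // Eab ?divff ?mon_neq0.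
have deg_ab : mdeg a = mdeg b.
  by move/dhomogP: fd => fd; have := fd _ fa; have := fd _ fb => /= -> ->.
have Hsum := laurent_val_sum (index_enum 'I_m) (fun j => laurent_valMz (beta j) (Hl j)).
have := @laurent_val_xm _ _ _ expo_xy x _ _ (a *+ p)%MM (b *+ p)%MM Xx Hsum.
rewrite !mdegMn deg_ab !wtMn -betaE -mulrnDl [wt expo_xy b + _]addrC subrK => /(_ erefl erefl).
rewrite !xmMn (eq_bigr (fun j => mon t0 (expo_y j *~ beta j))); last first.
  by move=> j _; rewrite monMz.
rewrite -mon_sum // -betaE monMn // monB // => e.
have {}e : xm x a = mon t0 (wt expo_xy a) / mon t0 (wt expo_xy b) * xm x b.
  by apply: (expp_inj char_k); rewrite exprMn.
by rewrite /phi e mulrC mulrA mulrA mulVf ?mon_neq0 // mul1r mulrC.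
Qed.

(** * The Gauss map in Pluecker coordinates *)

(** On the torus the quotients [x_i / y_j0] are the characters given by the rows
    of the unimodular matrix [Q], hence algebraically independent. *)
Lemma alg_indep_toric : alg_indep_functions X n.
Proof.
exists 1%N, (fun i => 'X_(ls i)), 'X_(rs j0); split=> [i||q qX].
- by rewrite dhomogX; apply/eqP/mdeg1.
- by rewrite dhomogX; apply/eqP/mdeg1.
pose w (a : 'X_{1..n}) : 'rV[int]_n := \sum_i row i Q *+ a i.
have w_inj : injective w.
  move=> a b wab; apply/mnmP => i; apply/eqP; rewrite -eqz_nat; apply/eqP.
  have wE c : w c *m invmx Q = \row_i (c i)%:Z.
    rewrite -[RHS](mulmxK unitQ); congr (_ *m _); rewrite mulmx_sum_row.
    by apply: eq_bigr => l _; rewrite mxE -[(c l)%:Z]natz scaler_nat.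
  by have /rowP/(_ i) := congr1 (mulmx^~ (invmx Q)) wab; rewrite !wE !mxE.
have sum0 t : in_torus t -> \sum_(a <- msupp q) q@_a * mon t (w a) = 0 :> k.
  move=> nt; have ptx : X (pt expo_xy t) by apply: (pts_toric (rs j0)); exists t.
  have := qX _ ptx; rewrite mevalXU pt_rs gauss_pt_j0 => /(_ (oner_neq0 _)) e.
  rewrite -[RHS]e mevalE; apply: eq_bigr => a _; congr (_ * _).
  rewrite /w mon_sum //; apply: eq_bigr => i _.
  by rewrite mevalXU divr1 mxE expo_xyL monMn.
exact: mpoly_torus_eq0 w_inj sum0.
Qed.

Lemma has_dim_toric : has_dim X n.
Proof. by split; [apply: alg_indep_toric|apply: not_alg_indep_toric]. Qed.

Local Notation PI := (pluecker_index n.+1 (n + m)).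

Lemma pluecker_mul (G : 'M[k]_n.+1) (B : 'M[k]_(n.+1, n + m)) :
  pluecker (G *m B) = \det G *: pluecker B.
Proof.
apply/rowP => I; rewrite !mxE -det_mulmx; congr (\det _).
by apply/matrixP => i j; rewrite !mxE; apply: eq_bigr => l _; rewrite mxE.
Qed.

Lemma tangent_mx_row0 (w : 'rV[k]_m) c :
  (tangent_mx w : 'M_(n.+1, n + m)) ord0 c = row_mx (0 : 'rV_n) w 0 c.
Proof.
have := col_mxEu (row_mx (0 : 'rV[k]_n) w) (row_mx 1%:M 0) ord0 c.
by have -> : lshift n ord0 = ord0 :> 'I_(1 + n) by apply: val_inj.
Qed.

Lemma tangent_mx_rowS (w : 'rV[k]_m) i c :
  (tangent_mx w : 'M_(n.+1, n + m)) (lift ord0 i) c = row_mx (1%:M : 'M_n) 0 i c.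
Proof.
have := col_mxEd (row_mx (0 : 'rV[k]_n) w) (row_mx 1%:M 0) i c.
by have -> : rshift 1 i = lift ord0 i :> 'I_(1 + n) by apply: val_inj.
Qed.

(** Only one row of [tangent_mx w] depends on [w], so its Pluecker coordinates
    are linear in [w]. *)
Definition pluecker_lin : 'M[k]_(m, #|PI|) :=
  \matrix_(j, I) pluecker (tangent_mx (delta_mx 0 j) : 'M_(n.+1, _)) 0 I.

Lemma pluecker_tangent_mx w : pluecker (tangent_mx w : 'M_(n.+1, _)) = w *m pluecker_lin.
Proof.
apply/rowP => I; rewrite !mxE; set h := tnth _.
(* Expanding along the first row, the cofactors do not depend on w. *)
pose Cf l := cofactor (colsub h (tangent_mx 0 : 'M_(n.+1, _))) ord0 l.
have detE w' : \det (colsub h (tangent_mx w' : 'M_(n.+1, _))) =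
    \sum_l (row_mx (0 : 'rV_n) w') 0 (h l) * Cf l.
  rewrite (expand_det_row _ ord0); apply: eq_bigr => l _; congr (_ * _).
    by rewrite mxE tangent_mx_row0.
  rewrite /Cf /cofactor; congr (_ * \det _); apply/matrixP => i c.
  do 2!rewrite [LHS]mxE [RHS]mxE; rewrite [LHS]mxE [RHS]mxE.
  by rewrite !tangent_mx_rowS.
rewrite detE; under [RHS]eq_bigr => j _ do rewrite !mxE -/h detE mulr_sumr.
rewrite exchange_big /=; apply: eq_bigr => l _.
under [RHS]eq_bigr => j _ do rewrite mulrA.
rewrite -mulr_suml; congr (_ * _); case: (splitP (h l)) => i il.
  have -> : h l = ls i by apply: val_inj.
  by rewrite row_mxEl mxE big1 // => j _; rewrite row_mxEl mxE mulr0.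
have -> : h l = rs i by apply: val_inj.
rewrite row_mxEr (bigD1 i) //= big1 ?addr0 => [|j /negPf nj].
  by rewrite row_mxEr mxE !eqxx mulr1.
by rewrite row_mxEr mxE [i == j]eq_sym nj andbF mulr0.
Qed.

(** The columns [x_1, ..., x_n, y_j], whose minor recovers the coordinate [j] of
    [w] up to sign. *)
Definition spanning_tuple (j : 'I_m) : n.+1.-tuple 'I_(n + m) :=
  [tuple if insub (val i) is Some i' then ls i' else rs j | i < n.+1].

Lemma spanning_tuple_lt j (i : 'I_n.+1) (lt_in : (i < n)%N) :
  tnth (spanning_tuple j) i = ls (Ordinal lt_in).
Proof. by rewrite tnth_mktuple insubT. Qed.

Lemma spanning_tuple_max j : tnth (spanning_tuple j) ord_max = rs j.
Proof. by rewrite tnth_mktuple insubF // ltnn. Qed.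

Lemma spanning_tuple_index j : spanning_tuple j \in PI.
Proof.
rewrite inE; apply/(sortedP 0%N) => i; rewrite size_map size_tuple => lti.
have lti' : (i < n.+1)%N by apply: ltnW.
have E l (ltl : (l < n.+1)%N) :
    nth 0%N [seq val x | x <- spanning_tuple j] l = tnth (spanning_tuple j) (Ordinal ltl).
  by rewrite (nth_map (rs j)) ?size_tuple // (tnth_nth (rs j)).
have lt_in : (i < n)%N by [].
rewrite !E (spanning_tuple_lt _ (i := Ordinal lti') lt_in) /=.
have [e|ne] := eqVneq i.+1 n.
  have -> : Ordinal lti = ord_max by apply: val_inj.
  by rewrite spanning_tuple_max /= ltn_addr.
have lt1 : (i.+1 < n)%N by rewrite ltn_neqAle ne.
by rewrite (spanning_tuple_lt _ (i := Ordinal lti) lt1).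
Qed.

Definition spanning_coord j : 'I_#|PI| := enum_rank_in (spanning_tuple_index j0) (spanning_tuple j).

Lemma pluecker_lin_coord (w : 'rV[k]_m) j :
  (w *m pluecker_lin) 0 (spanning_coord j) = (-1) ^+ n * w 0 j.
Proof.
rewrite -pluecker_tangent_mx mxE /spanning_coord enum_rankK_in ?spanning_tuple_index //.
rewrite (expand_det_row _ ord0) (bigD1 ord_max) //= big1 ?addr0 => [|l nl].
  rewrite mxE spanning_tuple_max tangent_mx_row0 row_mxEr mulrC; congr (_ * _).
  rewrite /cofactor [X in \det X](_ : _ = 1%:M) ?det1 ?mulr1 //.
  apply/matrixP => i c; do 3!rewrite [LHS]mxE.
  have ltc : (lift ord_max c < n)%N by rewrite lift_max.
  rewrite tangent_mx_rowS (spanning_tuple_lt _ ltc) row_mxEl; congr (fun_of_matrix _ _ _).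
  by apply: val_inj; apply: lift_max.
have ltl : (l < n)%N.
  rewrite ltn_neqAle -ltnS ltn_ord andbT; apply: contraNneq nl => e.
  by apply/eqP/val_inj.
by rewrite mxE (spanning_tuple_lt _ ltl) tangent_mx_row0 row_mxEl mxE mul0r.
Qed.

Lemma pluecker_lin_free : row_free pluecker_lin.
Proof.
apply: inj_row_free => w wJ; apply/rowP => j; have := pluecker_lin_coord w j.
rewrite wJ !mxE => /esym/eqP; rewrite mulf_eq0 signr_eq0 => /eqP.
by move=> ->.
Qed.

Lemma pluecker_lin_eq0 (w : 'rV[k]_m) : w *m pluecker_lin = 0 -> w = 0.
Proof. by move=> e; apply: (row_free_inj pluecker_lin_free); rewrite e mul0mx. Qed.

Lemma sub_tangent_mx_scale (w : 'rV[k]_m) c : c != 0 ->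
  [set v : 'rV_(n + m) | (v <= tangent_mx (c *: w))%MS] =
  [set v : 'rV_(n + m) | (v <= tangent_mx w)%MS].
Proof.
move=> c0; rewrite eqEsubset; split=> v /sub_tangent_mx[d vE]; apply/sub_tangent_mx.
  by exists (d * c); rewrite vE scalerA.
by exists (d / c); rewrite vE scalerA divfK.
Qed.

Lemma gauss_basis_pluecker_lin x (B : 'M[k]_(n.+1, n + m)) : gauss_basis X x B ->
  exists w : 'rV[k]_m, [/\ w != 0, tangent_space X x = [set v | (v <= tangent_mx w)%MS]
    & pluecker B = w *m pluecker_lin].
Proof.
move=> [_ Xx freeB TB]; have [w w0 TE] := tangent_shape Xx freeB TB.
have : (B <= tangent_mx w)%MS.
  apply/row_subP => i; have : tangent_space X x (row i B).
    by rewrite -TB; apply: row_sub.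
  by rewrite TE.
move=> /submxP[G BE].
have detG : \det (G : 'M_n.+1) != 0.
  rewrite -unitfE -unitmxE -row_free_unit -row_leq_rank -{1}(eqP freeB) BE.
  exact: mxrankM_maxl.
exists (\det (G : 'M_n.+1) *: w); split.
- by rewrite scaler_eq0 negb_or detG.
- by rewrite sub_tangent_mx_scale.
- by rewrite BE pluecker_mul pluecker_tangent_mx scalemxAl.
Qed.

Lemma gauss_basis_tangent_mx x w : X x -> w != 0 ->
  tangent_space X x = [set v | (v <= tangent_mx w)%MS] ->
  gauss_basis X x (tangent_mx w : 'M_(n.+1, _)).
Proof. by move=> Xx w0 TE; split=> //; [apply: has_dim_toric|apply: row_free_tangent_mx]. Qed.

Lemma gauss_pt_neq0 t : in_torus t -> gauss_pt t != 0 :> 'rV[k]_m.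
Proof. by move=> nt; apply: pt_neq0 j0 nt. Qed.

Lemma gauss_image_pt t : in_torus t -> gauss_image n X (gauss_pt t *m pluecker_lin).
Proof.
move=> nt; exists (pt expo_xy t), (tangent_mx (gauss_pt t)).
split; last by rewrite pluecker_tangent_mx.
apply: gauss_basis_tangent_mx; [|exact: gauss_pt_neq0|exact: tangent_pt].
by apply: (pts_toric (rs j0)); exists t.
Qed.

Lemma zclosure_gauss_image :
  zclosure (gauss_image n X) = [set w *m pluecker_lin | w in toric expo_y].
Proof.
rewrite -(zclosure_linear _ pluecker_lin_free) eqEsubset; split.
  apply: zclosure_sub => _ [x [B [gB ->]]].
  have [w [w0 TE ->]] := gauss_basis_pluecker_lin gB; case: gB => _ Xx _ _.
  by rewrite (zclosure_linear _ pluecker_lin_free); exists w => //; apply: gauss_closure TE.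
apply: zclosureS => _ [_ [t nt <-] <-]; exact: gauss_image_pt.
Qed.

(** The fiber of the Gauss map through the point of parameter [t0], boundary
    points included ([gauss_fiberE]). *)
Definition gauss_locus t0 : set 'rV[k]_(n + m) :=
  [set x | X x /\ tangent_space X x = [set v | (v <= tangent_mx (gauss_pt t0))%MS]].

Lemma gauss_fiberE s t0 : s != 0 -> in_torus t0 ->
  gauss_fiber n X ((s *: gauss_pt t0) *m pluecker_lin) = gauss_locus t0.
Proof.
move=> s0 nt0; rewrite eqEsubset; split=> x.
  move=> [B [gB]]; have [w [w0 TE ->]] := gauss_basis_pluecker_lin gB.
  move=> /(row_free_inj pluecker_lin_free) wE; case: gB => _ Xx _ _; split=> //.
  by rewrite TE -wE sub_tangent_mx_scale.
move=> [Xx TE]; exists (tangent_mx (s *: gauss_pt t0)); split; last by rewrite pluecker_tangent_mx.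
apply: gauss_basis_tangent_mx; rewrite ?sub_tangent_mx_scale //.
by rewrite scaler_eq0 negb_or s0 gauss_pt_neq0.
Qed.

(** The excluded closed set is where some coordinate [y_j] of the Gauss image
    vanishes; it misses the image of the torus, which is dense in the image. *)
Lemma general_gauss_fiber_locus (P : set 'rV[k]_(n + m) -> Prop) :
  (forall w : 'rV[k]_m, toric expo_y w -> (forall j, w 0 j != 0) ->
     exists s t, [/\ s != 0, in_torus t & w = s *: gauss_pt t]) ->
  (forall t0, in_torus t0 -> P (gauss_locus t0)) -> general_gauss_fiber n X P.
Proof.
move=> Htor HP; rewrite /general_gauss_fiber zclosure_gauss_image.
pose Pi : {mpoly k[#|PI|]} := \prod_j 'X_(spanning_coord j).
exists (zero_locus [set Pi]); split.
- exists [set Pi]; split=> // _ ->; exists (\sum_(j < m) 1)%N.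
  rewrite /Pi; elim/big_rec2: _ => [|j d q _ Hq]; first exact: dhomog1.
  by apply: dhomogM => //; rewrite dhomogX; apply/eqP/mdeg1.
- rewrite -(zclosure_linear _ pluecker_lin_free); apply: zclosureS => y wJ.
  split.
    apply: sub_zclosure wJ => _ [_ [t nt <-] <-]; apply/eqP => /pluecker_lin_eq0/eqP.
    by rewrite (negPf (gauss_pt_neq0 nt)).
  case: wJ => _ [t nt <-] <- [_ /(_ Pi erefl)/eqP]; apply/negP.
  rewrite rmorph_prod; apply/prodf_neq0 => j _ /=.
  by rewrite mevalXU pluecker_lin_coord mulf_neq0 ?signr_eq0 // gauss_ptE mon_neq0.
move=> _ [w wtor <-] nC.
have wn j : w 0 j != 0.
  apply/eqP => wj; apply: nC; split.
    have [w0 _] := (zclosureP _ _).1 wtor; apply: contraNneq w0 => e.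
    by rewrite (pluecker_lin_eq0 e).
  move=> _ ->; rewrite rmorph_prod (bigD1 j) //= mevalXU pluecker_lin_coord wj mulr0 mul0r //.
have [s [t [s0 nt ->]]] := Htor _ wtor wn.
by rewrite gauss_fiberE //; apply: HP.
Qed.

End Geometry.

(** * Irreducibility of torus cosets and roots of unity *)

(** Translating all exponents by a constant changes points by a scalar only, so
    the coset is parametrized by honest monomials; pulling back along this
    parametrization lands in a polynomial ring, which has no zero divisors. *)
Lemma irreducible_cosets (k : closedFieldType) (r N : nat) (e : 'I_N -> 'rV[int]_r)
    (kap : 'I_N -> k) (Z : set 'rV[k]_N)
    (S := [set \row_i (kap i * mon t (e i)) | t in in_torus]) :
  S `<=` Z -> Z `<=` zclosure S -> irreducible Z.
Proof.
move=> SZ ZS; apply: (irreducible_between _ SZ ZS).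
  by exists (\row_i (kap i * mon (const_mx 1) (e i))), (const_mx 1) => //; apply: in_torus_const1.
move=> d1 d2 f1 f2 f1d f2d f12.
(* Adding b to all exponents makes them nonnegative. *)
pose b := (\sum_(i < N) \sum_(l < r) `|e i 0%R l|)%N.
have be i l : 0 <= e i 0 l + b%:Z.
  have le : (`|e i 0%R l| <= b)%N.
    by rewrite /b (bigD1 i) //= (bigD1 l) //= -addnA leq_addr.
  rewrite -[b%:Z]opprK Num.Theory.subr_ge0.
  apply: Order.POrderTheory.le_trans (_ : - `|e i 0 l| <= _); last exact: Num.Theory.lerNnormlW.
  by rewrite Num.Theory.lerN2 -abszE lez_nat.
pose mn i : 'X_{1..r} := [multinom absz (e i 0 l + b%:Z)%R | l < r].
pose P i : {mpoly k[r]} := kap i *: 'X_[mn i].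
pose sh (t : 'rV[k]_r) := \prod_l t 0 l ^+ b.
have PE i (t : 'rV[k]_r) : in_torus t -> (P i).@[t 0] = sh t * (kap i * mon t (e i)).
  move=> nt; rewrite mevalZ mulrCA; congr (_ * _).
  rewrite mevalX /sh /mon -big_split /=; apply: eq_bigr => l _.
  rewrite mnmE [RHS]mulrC -[t 0 l ^+ b]/(t 0 l ^ b%:Z) -expfzDr //.
  by rewrite -{2}(gez0_abs (be i l)).
have compE d f t : f \is d.-homog -> in_torus t -> (f \mPo [tuple P i | i < N]).@[t 0] =
    sh t ^+ d * f.@[(\row_i (kap i * mon t (e i))) 0].
  move=> fd nt; rewrite meval_comp -(meval_dhomogZ _ _ fd).
  by apply: meval_eq => i; rewrite PE // !mxE.
have sh0 t : in_torus t -> sh t != 0.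
  by move=> nt; apply/prodf_neq0 => l _; rewrite expf_neq0.
have : (f1 \mPo [tuple P i | i < N]) * (f2 \mPo [tuple P i | i < N]) = 0.
  apply: (@mpoly_torus_eq0 _ _ r _ (fun a => \row_l (a l)%:Z)).
    by move=> a1 a2 /rowP eqa; apply/mnmP => l; have := eqa l; rewrite !mxE => -[].
  move=> t nt.
  have tS : S (\row_i (kap i * mon t (e i))) by exists t.
  have : ((f1 \mPo [tuple P i | i < N]) * (f2 \mPo [tuple P i | i < N])).@[t 0] = 0.
    by rewrite mevalM (compE _ _ _ f1d nt) (compE _ _ _ f2d nt) mulrACA f12 ?mulr0.
  rewrite mevalE => e0; rewrite -[RHS]e0; apply: eq_bigr => a _; congr (_ * _).
  by apply: eq_bigr => l _; rewrite mxE.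
move/eqP; rewrite mulf_eq0 => /orP[]/eqP c0; [left|right] => _ [t nt <-].
  have := compE _ _ _ f1d nt; rewrite c0 meval0 => /esym/eqP.
  by rewrite mulf_eq0 (negPf (expf_neq0 _ (sh0 _ nt))) => /eqP.
have := compE _ _ _ f2d nt; rewrite c0 meval0 => /esym/eqP.
by rewrite mulf_eq0 (negPf (expf_neq0 _ (sh0 _ nt))) => /eqP.
Qed.

Lemma closed_root (k : closedFieldType) (z : k) (e : nat) : (0 < e)%N ->
  exists x, x ^+ e = z.
Proof.
case: e => // e _; have [x xE] := @solve_monicpoly k e.+1
  (fun i => if i == 0%N then z else 0) isT.
exists x; rewrite xE big_ord_recl big1 /= ?addr0 ?expr0 ?mulr1 // => i _.
by rewrite mul0r.
Qed.

Lemma exists_unity_roots (k : closedFieldType) (c : nat) : c%:R != 0 :> k ->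
  exists rts : seq k, [/\ uniq rts, size rts = c & forall z, (z \in rts) = (z ^+ c == 1)].
Proof.
move=> c0; have [rts rtsE] := closed_field_poly_normal ('X^c - 1 : {poly k}).
have cgt0 : (0 < c)%N by rewrite lt0n; apply: contraNneq c0 => ->.
rewrite lead_coefXnsubC // scale1r in rtsE; exists rts; split.
- rewrite -separable_prod_XsubC -rtsE; exact: separable_Xn_sub_1.
- by apply: succn_inj; rewrite -(size_prod_XsubC rts id) -rtsE size_XnsubC.
by move=> z; rewrite -root_prod_XsubC -rtsE rootE !hornerE subr_eq0.
Qed.

(** * The exponents realizing the prescribed fibers and image *)

Section ExplicitWeights.
Variables (k : closedFieldType) (p : nat) (char_k : p \in [pchar k]).
Variables (c : nat) (c_gt0 : (0 < c)%N) (coprime_c_p : coprime c p).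
Variables (r1 s m : nat) (Q : 'M[int]_(r1 + s.+1)) (v : 'I_m -> 'rV[int]_s.+1).
Variables (j0 : 'I_m).
Hypotheses (unitQ : Q \in unitmx) (v0 : v j0 = 0)
  (v_gen : forall z, exists beta : 'I_m -> int, z = \sum_j v j *~ beta j).

Local Notation n := (r1 + s.+1)%N.

(** The dilation by [diag(c, 1, ..., 1)]: its cokernel, of order [c] prime to [p],
    accounts for the [c] components of the kernel of the Gauss map, whereas the
    factor [p] put in front of it only contributes inseparability. *)
Definition dil_factor (l : 'I_s.+1) : nat := if l == ord0 then c else 1.
Definition dil (z : 'rV[int]_s.+1) : 'rV[int]_s.+1 := \row_l (z 0 l *+ dil_factor l).
Definition expo_dil (j : 'I_m) : 'rV[int]_n := row_mx 0 (dil (v j)).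

Local Notation eY := (expo_y p expo_dil).
Local Notation eXY := (expo_xy p Q expo_dil).

Lemma pchar_gt0 : (0 < p)%N.
Proof. by case/andP: char_k => /prime_gt0. Qed.

Lemma dil_factor_gt0 l : (0 < dil_factor l)%N.
Proof. by rewrite /dil_factor; case: ifP. Qed.

Lemma expo_dil0 : expo_dil j0 = 0.
Proof.
rewrite /expo_dil v0 -row_mx0; congr row_mx.
by apply/rowP => l; rewrite !mxE mul0rn.
Qed.

(** The homomorphism of tori dual to the dilation; the Gauss map on the torus
    factors through it ([mon_expo_y]). *)
Definition dil_coord (t : 'rV[k]_n) : 'rV[k]_s.+1 := \row_l rsubmx t 0 l ^+ (p * dil_factor l).

Lemma in_torus_dil_coord t : in_torus t -> in_torus (dil_coord t).
Proof. by move=> nt l; rewrite !mxE expf_neq0. Qed.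

Definition dil_emb (z : 'rV[int]_s.+1) : 'rV[int]_n := row_mx 0 (dil z) *+ p.

Lemma mon_dil_emb t z : in_torus t -> mon t (dil_emb z) = mon (dil_coord t) z.
Proof.
move=> nt; rewrite monMn // mon_row_mx mon0 mul1r /mon -prodrXl.
apply: eq_bigr => l _; rewrite !mxE.
rewrite [LHS]exprnP [_ ^+ (p * _)]exprnP !exprz_exp; congr (_ ^ _).
by rewrite -mulr_natr natz PoszM -mulrA [RHS]mulrC; congr (_ * _); apply: mulrC.
Qed.

Lemma dil_embD : {morph dil_emb : x y / x + y}.
Proof.
move=> x y; rewrite /dil_emb -mulrnDl add_row_mx addr0; congr (row_mx _ _ *+ p).
by apply/rowP => l; rewrite !mxE mulrnDl.
Qed.

Lemma dil_emb0 : dil_emb 0 = 0.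
Proof. by apply: (addrI (dil_emb 0)); rewrite -dil_embD !addr0. Qed.

Lemma dil_embMz z (b : int) : dil_emb (z *~ b) = dil_emb z *~ b.
Proof.
apply/rowP => l; rewrite -!scaler_int /dil_emb mulmxnE [RHS]mxE mulmxnE.
case: (splitP l) => i il.
  have -> : l = lshift s.+1 i by apply: val_inj.
  by rewrite !row_mxEl !mxE mul0rn mulr0.
have -> : l = rshift r1 i by apply: val_inj.
by rewrite !row_mxEr !mxE !mulrnAr.
Qed.

Lemma sum_expo_y (beta : 'I_m -> int) :
  \sum_j eY j *~ beta j = dil_emb (\sum_j v j *~ beta j).
Proof. by rewrite (big_morph _ dil_embD dil_emb0); apply: eq_bigr => j _; rewrite dil_embMz. Qed.

Lemma mon_expo_y t j : in_torus t -> mon t (eY j) = mon (dil_coord t) (v j).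
Proof. exact: mon_dil_emb. Qed.

Lemma dil_coord_surj (y : 'rV[k]_s.+1) : in_torus y -> exists2 t, in_torus t & dil_coord t = y.
Proof.
move=> ny; have root l : exists x, x ^+ (p * dil_factor l) = y 0 l.
  by apply: closed_root; rewrite muln_gt0 pchar_gt0 dil_factor_gt0.
pose x l := projT1 (cid (root l)).
have xE l : x l ^+ (p * dil_factor l) = y 0 l by rewrite /x; case: cid.
exists (row_mx (const_mx 1) (\row_l x l)).
  move=> l; case: (splitP l) => i il.
    have -> : l = lshift s.+1 i by apply: val_inj.
    by rewrite row_mxEl mxE oner_neq0.
  have -> : l = rshift r1 i by apply: val_inj.
  rewrite row_mxEr mxE; apply: contraNneq (ny i) => x0.
  by rewrite -xE x0 expr0n muln_eq0 !eqn0Ngt pchar_gt0 dil_factor_gt0.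
by apply/rowP => l; rewrite mxE row_mxKr mxE xE.
Qed.

Lemma mon_gen_inj (y y' : 'rV[k]_s.+1) : in_torus y -> in_torus y' ->
  (forall j, mon y (v j) = mon y' (v j)) -> y = y'.
Proof.
move=> ny ny' e; apply/rowP => l; rewrite -!mon_delta.
have [beta ->] := v_gen (delta_mx 0 l).
by rewrite !mon_sum //; apply: eq_bigr => j _; rewrite !monMz // e.
Qed.

(** A point of the toric variety with nonzero coordinates is in the orbit of the
    torus. Its coordinates define a character of the lattice generated by the
    [v j], which extends to the whole torus because [k*] is divisible. *)
Lemma toric_expo_y_torus (w : 'rV[k]_m) : toric eY w -> (forall j, w 0 j != 0) ->
  exists a t, [/\ a != 0, in_torus t & w = a *: gauss_pt p expo_dil t].
Proof.
move=> wtor wn.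
pose y j := w 0 j / w 0 j0.
have yl j : laurent_val eY w (eY j) (y j).
  have := @laurent_val_coord k _ _ eY w j j0 (y j) (wn j) (wn j0).
  rewrite {3}/expo_y expo_dil0 mul0rn subr0; apply.
  by rewrite /y divfK.
have ex_beta l := v_gen (delta_mx 0 l).
pose beta l := projT1 (cid (ex_beta l)).
have betaE l : delta_mx 0 l = \sum_j v j *~ beta l j by rewrite /beta; case: cid.
(* The value of the character at the l-th basis vector of the lattice. *)
pose sg : 'rV[k]_s.+1 := \row_l \prod_j y j ^ beta l j.
have yn j : y j != 0 by rewrite mulf_neq0 ?invr_eq0.
have nsg : in_torus sg by move=> l; rewrite mxE; apply/prodf_neq0 => j _; rewrite expfz_neq0.
have [t nt sigt] := dil_coord_surj nsg.
exists (w 0 j0), t; split=> //; apply/rowP => j; rewrite mxE gauss_ptE mon_expo_y // sigt.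
have sgl l : laurent_val eY w (dil_emb (delta_mx 0 l)) (sg 0 l).
  rewrite mxE betaE -sum_expo_y.
  exact: (laurent_val_sum (index_enum 'I_m) (fun j => laurent_valMz (beta l j) (yl j))).
have vE : v j = \sum_l delta_mx 0 l *~ v j 0 l.
  rewrite {1}[v j]row_sum_delta; apply: eq_bigr => l _.
  by rewrite -scaler_int intz.
have evE : eY j = \sum_l dil_emb (delta_mx 0 l) *~ v j 0 l.
  rewrite -[LHS]/(dil_emb (v j)) {1}vE (big_morph _ dil_embD dil_emb0).
  by apply: eq_bigr => l _; rewrite dil_embMz.
have l2 := laurent_val_sum (index_enum 'I_s.+1) (fun l => laurent_valMz (v j 0 l) (sgl l)).
rewrite -evE in l2; have := laurent_val_fun wtor (yl j) l2 => yE.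
by rewrite /mon -yE /y mulrCA divff ?mulr1.
Qed.

Lemma toric_expo_yE (a : 'I_m -> 'rV[int]_s.+1) (b : 'rV[int]_s.+1) :
  (forall j, a j = v j + b) -> toric eY = toric a :> set 'rV[k]_m.
Proof.
move=> aE; have scale t : in_torus t -> pt a (dil_coord t) = mon (dil_coord t) b *: pt eY t.
  move=> nt; have ns := in_torus_dil_coord nt; apply/rowP => j.
  by rewrite [LHS]mxE [RHS]mxE [pt eY t 0 j]mxE mon_expo_y // aE monD // mulrC.
rewrite eqEsubset; split; apply: zclosure_sub => _ [y ny <-].
  have -> : pt eY y = (mon (dil_coord y) b)^-1 *: pt a (dil_coord y).
    by rewrite scale // scalerA mulVf ?scale1r // mon_neq0 //; apply: in_torus_dil_coord.
  apply: zclosureZ; first by rewrite invr_eq0 mon_neq0 //; apply: in_torus_dil_coord.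
  by apply: (pts_toric j0); exists (dil_coord y) => //; apply: in_torus_dil_coord.
have [t nt <-] := dil_coord_surj ny; rewrite scale //.
apply: zclosureZ; first by rewrite mon_neq0 //; apply: in_torus_dil_coord.
by apply: (pts_toric j0); exists t.
Qed.

Lemma root_neq0 (z : k) : z ^+ c = 1 -> z != 0.
Proof.
move=> zc; apply: contraTneq (oner_neq0 k) => z0; rewrite negbK -zc z0.
by rewrite expr0n eqn0Ngt c_gt0.
Qed.

Lemma c_neq0 : c%:R != 0 :> k.
Proof.
rewrite -(dvdn_pcharf char_k); apply/negP => spanning_coord.
have := coprime_c_p; rewrite /coprime (gcdn_idPr spanning_coord) => /eqP p1.
by case/andP: char_k; rewrite p1.
Qed.

(** The characters trivial on the kernel of the Gauss map are, up to a factor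
    [p], generated by the [expo_y j]. Testing on the subtorus [k*^r1] kills the
    first coordinates; testing on the [c]-th roots of unity makes the next one
    divisible by [c], as a nonzero polynomial [X ^ e - 1] with [e < c] cannot
    have [c] roots. *)
Lemma kernel_chars (u : 'rV[int]_n) :
  (forall h : 'rV[k]_n, in_torus h -> (forall j, mon h (eY j) = 1) -> mon h u = 1) ->
  exists beta : 'I_m -> int, u *+ p = \sum_j eY j *~ beta j.
Proof.
move=> Hu.
have ul l : u 0 (lshift s.+1 l) = 0.
  apply: (@expz_sep k) => x x0; rewrite -mon_one_coord expr0z Hu //.
    exact: in_torus_one_coord.
  move=> j; rewrite mon_one_coord mulmxnE row_mxEl mxE mul0rn expr0z //.
have [rts [uniq_rts size_rts rtsE]] := exists_unity_roots c_neq0.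
have cu : (c %| u 0%R (rshift r1 ord0))%Z.
  set z := u 0 _.
  have zr x : x \in rts -> x ^ z = 1.
    rewrite rtsE => /eqP xc; rewrite -mon_one_coord.
    have x0 := root_neq0 xc.
    apply: Hu => [|j]; first exact: in_torus_one_coord.
    rewrite mon_one_coord mulmxnE row_mxEr mxE /dil_factor eqxx.
    rewrite -mulrnA mulnC mulrnA -mulr_natl natz -exprz_exp -exprnP exprnP.
    by rewrite -exprnP xc exp1rz.
  rewrite dvdzE; apply/dvdzP; exists (z %/ c)%Z.
  have rem0 : (z %% c)%Z = 0.
    have ge0 : 0 <= (z %% c)%Z by rewrite modz_ge0 // eqz_nat -lt0n.
    have lt : (z %% c)%Z < c%:Z by rewrite ltz_pmod // ltz_nat.
    move: ge0 lt (divz_eq z c); case: (z %% c)%Z => // e _; rewrite ltz_nat => lt zE.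
    case: e lt zE => // e lt zE.
    have : all (e.+1).-unity_root rts.
      apply/allP => x xr; rewrite unity_rootE; apply/eqP.
      have := zr x xr; rewrite zE.
      have xc : x ^+ c = 1 by apply/eqP; rewrite -rtsE.
      have ux : x \is a GRing.unit by rewrite unitfE root_neq0.
      by rewrite exprzDr // [(z %/ c)%Z * _]mulrC -exprz_exp -exprnP xc exp1rz mul1r.
    move=> /(max_unity_roots (ltn0Sn e)) /(_ uniq_rts); rewrite size_rts leqNgt.
    by rewrite lt.
  by rewrite {1}(divz_eq z c) rem0 addr0.
pose z : 'rV[int]_s.+1 := \row_l divz (u 0 (rshift r1 l)) (dil_factor l).
have uE : u = row_mx 0 (dil z).
  apply/rowP => l; case: (splitP l) => i il.
    have -> : l = lshift s.+1 i by apply: val_inj.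
    by rewrite ul row_mxEl mxE.
  have -> : l = rshift r1 i by apply: val_inj.
  rewrite row_mxEr !mxE -mulr_natr natz divzK //.
  by rewrite /dil_factor; case: eqP => [->//|_]; apply: dvd1z.
have [beta zE] := v_gen z; exists beta.
by rewrite sum_expo_y -zE /dil_emb -uE.
Qed.

Variables (m1 : nat) (a' : 'I_m1 -> 'rV[int]_r1) (i0 : 'I_m1) (alpha : 'I_n -> 'I_m1).
Hypotheses (Q_alpha : forall i, lsubmx (row i Q) = a' (alpha i) - a' i0)
  (alpha_surj : forall l, l != i0 -> exists i, alpha i = l).

Local Notation X := (@toric k n (n + m) eXY).

(** * Components of a general fiber *)

Section Fiber.
Variables (t0 : 'rV[k]_n) (nt0 : in_torus t0).

(** The last coordinates of [t0], the first of them multiplied by a [c]-th root of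
    unity [z]: one value of [z] for each component of the fiber. *)
Definition coset_tail (z : k) : 'rV[k]_s.+1 :=
  \row_l ((if l == ord0 then z else 1) * rsubmx t0 0 l).

Definition fiber_coset (z : k) : set 'rV[k]_(n + m) :=
  [set pt eXY (row_mx t (coset_tail z)) | t in in_torus].

Lemma in_torus_coset (z : k) (t : 'rV[k]_r1) :
  z != 0 -> in_torus t -> in_torus (row_mx t (coset_tail z)).
Proof.
move=> z0 nt l; case: (splitP l) => i il.
  have -> : l = lshift s.+1 i by apply: val_inj.
  by rewrite row_mxEl.
have -> : l = rshift r1 i by apply: val_inj.
rewrite row_mxEr !mxE mulf_neq0 //; case: ifP; rewrite ?oner_eq0 //.
Qed.

Lemma dil_coord_coset (z : k) (t : 'rV[k]_r1) : z ^+ c = 1 ->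
  dil_coord (row_mx t (coset_tail z)) = dil_coord t0.
Proof.
move=> zc; apply/rowP => l; rewrite [LHS]mxE [RHS]mxE row_mxKr mxE exprMn.
rewrite /dil_factor; case: eqP => _; last by rewrite expr1n mul1r.
by rewrite mulnC exprM zc expr1n mul1r.
Qed.

Lemma gauss_pt_coset (z : k) (t : 'rV[k]_r1) : z ^+ c = 1 -> in_torus t ->
  gauss_pt p expo_dil (row_mx t (coset_tail z)) = gauss_pt p expo_dil t0.
Proof.
move=> zc nt; apply/rowP => j; rewrite !gauss_ptE !mon_expo_y ?dil_coord_coset //.
exact/in_torus_coset/nt/root_neq0.
Qed.

Local Notation F := (gauss_locus p Q expo_dil t0).

Lemma fiber_coset_sub (z : k) : z ^+ c = 1 -> fiber_coset z `<=` F.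
Proof.
move=> zc _ [t nt <-]; have nt' := in_torus_coset (root_neq0 zc) nt; split.
  by apply: (pts_toric (rshift n j0)); exists (row_mx t (coset_tail z)).
by rewrite (tangent_pt char_k unitQ expo_dil0 nt') gauss_pt_coset.
Qed.

(** By [fiber_closure] it is enough to consider points of the torus. There the
    Gauss map determines [dil_coord t], hence the last coordinates of [t] up
    to a [c]-th root of unity in the first of them, as [p]-th roots are unique. *)
Lemma fiber_sub_cosets (rts : seq k) : (forall z, (z \in rts) = (z ^+ c == 1)) ->
  F `<=` zclosure [set x | exists2 z, z \in rts & fiber_coset z x].
Proof.
move=> rtsE x [Xx TE].
have := fiber_closure char_k unitQ expo_dil0 Xx nt0 kernel_chars TE.
apply: zclosureS => _ [t [nt wt0] <-].
have sigE : dil_coord t = dil_coord t0.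
  apply: mon_gen_inj; [exact: in_torus_dil_coord|exact: in_torus_dil_coord|move=> j].
  by rewrite -!mon_expo_y // -!gauss_ptE wt0.
have delE l : rsubmx t 0 l ^+ dil_factor l = rsubmx t0 0 l ^+ dil_factor l.
  apply: (expp_inj char_k); rewrite -!exprM mulnC.
  by have /rowP/(_ l) := sigE; rewrite [LHS]mxE [RHS]mxE.
have t0n l : rsubmx t0 0 l != 0 by rewrite mxE.
exists (rsubmx t 0 ord0 / rsubmx t0 0 ord0).
  rewrite rtsE expr_div_n; have := delE ord0; rewrite /dil_factor eqxx => ->.
  by rewrite divff ?expf_neq0.
exists (lsubmx t); first by move=> l; rewrite mxE.
congr pt; rewrite -[RHS]hsubmxK; congr row_mx; apply/rowP => l.
rewrite [LHS]mxE; have := delE l; rewrite /dil_factor; case: eqP => [->|_].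
  by rewrite divfK.
by rewrite !expr1 mul1r => ->.
Qed.

(** As [Q] is unimodular, the coordinate which is multiplied by [z] is a
    quotient of two monomials of the same degree, so it is a function on [X]
    that distinguishes the cosets. *)
Lemma fiber_coset_sep (z z' : k) (t : 'rV[k]_r1) : z ^+ c = 1 -> z' ^+ c = 1 -> in_torus t ->
  zclosure (fiber_coset z') (pt eXY (row_mx t (coset_tail z))) -> z = z'.
Proof.
move=> zc zc' nt.
have [A [B [degAB wtAB]]] := exists_deg0_wt k p unitQ expo_dil0 (delta_mx 0 (rshift r1 ord0)).
pose b := z' * rsubmx t0 0 ord0.
pose f : {mpoly k[n + m]} := 'X_[A] - b *: 'X_[B].
have fE y t' : y ^+ c = 1 -> in_torus t' -> f.@[pt eXY (row_mx t' (coset_tail y)) 0] =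
    mon (row_mx t' (coset_tail y)) (wt eXY B) * (y * rsubmx t0 0 ord0 - b).
  move=> yc nt'; have nt2 := in_torus_coset (root_neq0 yc) nt'.
  rewrite mevalB mevalZ !xmE !xm_pt // wtAB monD // mon_delta row_mxEr.
  by rewrite [coset_tail y 0 ord0]mxE eqxx mulrBr [b * _]mulrC.
have fd : f \is (mdeg B).-homog by rewrite rpredB ?rpredZ // dhomogX; apply/eqP.
move=> /(zclosure_homog fd) => H.
have : f.@[pt eXY (row_mx t (coset_tail z)) 0] = 0.
  by apply: H => _ [t' nt' <-]; rewrite fE // subrr mulr0.
rewrite fE // => /eqP; rewrite mulf_eq0 (negPf (mon_neq0 _ (in_torus_coset (root_neq0 zc) nt))) /=.
rewrite subr_eq0 => /eqP; apply: mulIf; by rewrite mxE.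
Qed.

Lemma fiber_coset_irreducible (z : k) (Z : set 'rV[k]_(n + m)) :
  z ^+ c = 1 -> fiber_coset z `<=` Z -> Z `<=` zclosure (fiber_coset z) ->
  irreducible Z.
Proof.
move=> zc.
pose e (i : 'I_(n + m)) : 'rV[int]_r1 := lsubmx (eXY i).
pose kap (i : 'I_(n + m)) : k := mon (coset_tail z) (rsubmx (eXY i)).
have -> : fiber_coset z = [set \row_i (kap i * mon t (e i)) | t in in_torus].
  have ptE t : pt eXY (row_mx t (coset_tail z)) = \row_i (kap i * mon t (e i)).
    apply/rowP => i; rewrite [LHS]mxE [RHS]mxE -[eXY i]hsubmxK mon_row_mx.
    by rewrite row_mxKl row_mxKr mulrC.
  by rewrite eqEsubset; split=> _ [t nt <-]; exists t; rewrite ?ptE.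
exact: irreducible_cosets.
Qed.

Definition coset_component z := F `&` zclosure (fiber_coset z).

Lemma fiber_coset_sub_component (z : k) : z ^+ c = 1 -> fiber_coset z `<=` coset_component z.
Proof.
move=> zc x Fx; split; first exact: fiber_coset_sub Fx.
apply: sub_zclosure Fx => _ [t nt <-]; apply: pt_neq0 (rshift n j0) _.
exact/in_torus_coset/nt/root_neq0.
Qed.

Lemma zclosure_coset_component (z : k) : z ^+ c = 1 ->
  zclosure (coset_component z) = zclosure (fiber_coset z).
Proof.
move=> zc; rewrite eqEsubset; split; last exact/zclosureS/fiber_coset_sub_component.
by apply: zclosure_sub => x [].
Qed.

Lemma irr_coset_component (z : k) : z ^+ c = 1 -> irreducible (coset_component z).
Proof.
by move=> zc; apply: (fiber_coset_irreducible zc); [exact: fiber_coset_sub_component|move=> x []].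
Qed.

Lemma fiber_coset_nonempty (z : k) : z ^+ c = 1 ->
  fiber_coset z (pt eXY (row_mx (const_mx 1) (coset_tail z))).
Proof. by move=> _; exists (const_mx 1) => //; apply: in_torus_const1. Qed.

(** The fiber is covered by the closures of finitely many irreducible cosets,
    none of which lies in the closure of another one. *)
Lemma irr_component_gauss_locus (rts : seq k) : (forall z, (z \in rts) = (z ^+ c == 1)) ->
  forall Z, irr_component F Z <-> exists2 z, z \in rts & Z = coset_component z.
Proof.
move=> rtsE Z.
have sub_cmp Z' : irreducible Z' -> Z' `<=` F -> exists2 z, z \in rts & Z' `<=` coset_component z.
  move=> irrZ Z'F.
  have [z zr Z'z] := irreducible_sub_bigcup irrZ (subset_trans Z'F (fiber_sub_cosets rtsE)).
  by exists z => // x Zx; split; [apply: Z'F|apply: Z'z].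
split=> [[irrZ ZF maxZ]|[z zr ->]].
  have [z zr Zz] := sub_cmp _ irrZ ZF; exists z => //.
  move: (zr); rewrite rtsE => /eqP zc.
  by apply/esym/maxZ => //; [exact: irr_coset_component|move=> x []].
move: (zr); rewrite rtsE => /eqP zc; split; [exact: irr_coset_component|by move=> x []|].
move=> Z' irrZ' Z'F zZ'; have [z' zr' Z'z'] := sub_cmp _ irrZ' Z'F.
move: (zr'); rewrite rtsE => /eqP zc'.
have : coset_component z' (pt eXY (row_mx (const_mx 1) (coset_tail z))).
  by apply/Z'z'/zZ'/fiber_coset_sub_component => //; exact: fiber_coset_nonempty.
move=> [_ /(fiber_coset_sep zc zc' (@in_torus_const1 _ _))] ezz'; subst z'.
by rewrite eqEsubset.
Qed.

Lemma coset_component_inj (z z' : k) : z ^+ c = 1 -> z' ^+ c = 1 ->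
  coset_component z = coset_component z' -> z = z'.
Proof.
move=> zc zc' e; have : coset_component z (pt eXY (row_mx (const_mx 1) (coset_tail z))).
  by apply: fiber_coset_sub_component => //; exact: fiber_coset_nonempty.
by rewrite e => -[_ /(fiber_coset_sep zc zc' (@in_torus_const1 _ _))].
Qed.

Lemma card_irr_component : [set Z | irr_component F Z] #= `I_c.
Proof.
have [rts [uniq_rts size_rts rtsE]] := exists_unity_roots c_neq0.
have -> : [set Z | irr_component F Z] = (fun i => coset_component (nth 0 rts i)) @` `I_c.
  rewrite eqEsubset; split=> [Z /(irr_component_gauss_locus rtsE)[z zr ->]|_ [i ic <-]].
    by exists (index z rts); rewrite ?nth_index //= -size_rts index_mem.
  by apply/(irr_component_gauss_locus rtsE); exists (nth 0 rts i) => //; rewrite mem_nth ?size_rts.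
apply: inj_card_eq => i j; rewrite !inE => ic jc e.
have rc l : (l < c)%N -> nth 0 rts l ^+ c = 1.
  by move=> lc; apply/eqP; rewrite -rtsE mem_nth ?size_rts.
apply/eqP; rewrite -(nth_uniq 0 _ _ uniq_rts) ?size_rts //; apply/eqP.
by apply: coset_component_inj e; apply: rc.
Qed.

(** On a coset, [x_i] is a constant times the character [a' (alpha i) - a' i0] and
    [y_j] is a constant. The matrix [J] repeats and rescales the coordinates
    of the toric variety of [a'] accordingly. *)
Lemma coset_component_proj_equiv (z : k) : z ^+ c = 1 ->
  proj_equiv (zclosure (coset_component z)) (toric a' : set 'rV[k]_m1).
Proof.
move=> zc; rewrite zclosure_coset_component //; have z0 := root_neq0 zc.
pose kap i : k := mon (coset_tail z) (rsubmx (row i Q)).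
have ncst : in_torus (coset_tail z).
  move=> l; have := in_torus_coset z0 (@in_torus_const1 k r1) (rshift r1 l).
  by rewrite row_mxEr.
have kap0 i : kap i != 0 by apply: mon_neq0.
pose J : 'M[k]_(m1, n + m) := \matrix_(l, i)
  match split i with
  | inl i => (alpha i == l)%:R * kap i
  | inr j => (l == i0)%:R * gauss_pt p expo_dil t0 0 j
  end.
have JL (y : 'rV[k]_m1) i : (y *m J) 0 (lshift m i) = y 0 (alpha i) * kap i.
  rewrite mxE (bigD1 (alpha i)) //= big1 ?addr0 => [|l nl].
    by rewrite mxE -[split _]/(split (unsplit (inl i))) unsplitK eqxx mul1r.
  rewrite mxE -[split _]/(split (unsplit (inl i))) unsplitK eq_sym (negPf nl).
  by rewrite mul0r mulr0.
have JR (y : 'rV[k]_m1) j : (y *m J) 0 (rshift n j) = y 0 i0 * gauss_pt p expo_dil t0 0 j.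
  rewrite mxE (bigD1 i0) //= big1 ?addr0 => [|l nl].
    by rewrite mxE -[split _]/(split (unsplit (inr j))) unsplitK eqxx mul1r.
  rewrite mxE -[split _]/(split (unsplit (inr j))) unsplitK (negPf nl).
  by rewrite mul0r mulr0.
have freeJ : row_free J.
  apply: inj_row_free => y yJ; apply/rowP => l; rewrite mxE.
  have [->|nl] := eqVneq l i0.
    have := JR y j0; rewrite yJ mxE gauss_pt_j0 ?mulr1 //; exact: expo_dil0.
  have [i <-] := alpha_surj nl; have := JL y i; rewrite yJ mxE => /esym/eqP.
  by rewrite mulf_eq0 (negPf (kap0 i)) orbF => /eqP.
have scale t : in_torus t -> pt a' t *m J = mon t (a' i0) *: pt eXY (row_mx t (coset_tail z)).
  move=> nt; apply/rowP => i; case: (splitP i) => l il.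
    have -> : i = lshift m l by apply: val_inj.
    rewrite JL [RHS]mxE [pt eXY _ _ _]mxE expo_xyL -[row l Q]hsubmxK mon_row_mx.
    rewrite row_mxKl row_mxKr Q_alpha [pt a' _ _ _]mxE monB //.
    by rewrite mulrA mulrCA divff ?mulr1 ?mon_neq0.
  have -> : i = rshift n l by apply: val_inj.
  by rewrite JR [RHS]mxE pt_rs gauss_pt_coset // mxE.
suff -> : zclosure (fiber_coset z) = [set x *m J | x in toric a'] by apply: proj_equiv_linear.
rewrite -(zclosure_linear _ freeJ) eqEsubset; split; apply: zclosure_sub.
  move=> _ [t nt <-].
  have -> : pt eXY (row_mx t (coset_tail z)) = (mon t (a' i0))^-1 *: (pt a' t *m J).
    by rewrite scale // scalerA mulVf ?scale1r ?mon_neq0.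
  apply: zclosureZ; first by rewrite invr_eq0 mon_neq0.
  rewrite (zclosure_linear _ freeJ); exists (pt a' t) => //.
  by apply: (pts_toric i0); exists t.
move=> _ [_ [t nt <-] <-]; rewrite scale //.
apply: zclosureZ; first exact: mon_neq0.
apply: sub_zclosure; last by exists t.
by move=> _ [t' nt' <-]; apply: pt_neq0 (rshift n j0) _; apply: in_torus_coset.
Qed.

Lemma irr_component_proj_equiv Z : irr_component F Z ->
  proj_equiv (zclosure Z) (toric a' : set 'rV[k]_m1).
Proof.
have [rts [_ _ rtsE]] := exists_unity_roots c_neq0.
move=> /(irr_component_gauss_locus rtsE)[z zr ->]; apply: coset_component_proj_equiv.
by apply/eqP; rewrite -rtsE.
Qed.

End Fiber.

Lemma explicit_gauss (a : 'I_m -> 'rV[int]_s.+1) (b : 'rV[int]_s.+1) :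
  (forall j, a j = v j + b) ->
  [/\ general_gauss_fiber n X (fun F => forall Z, irr_component F Z ->
        proj_equiv (zclosure Z) (toric a' : set 'rV[k]_m1)),
      proj_equiv (zclosure (gauss_image n X)) (toric a : set 'rV[k]_m) &
      general_gauss_fiber n X (fun F => [set Z | irr_component F Z] #= `I_c)].
Proof.
move=> aE; split.
- apply: (general_gauss_fiber_locus char_k unitQ expo_dil0) => [w wt wn|t0 nt0 Z].
    exact: toric_expo_y_torus.
  exact: irr_component_proj_equiv.
- rewrite (zclosure_gauss_image char_k unitQ expo_dil0) (toric_expo_yE aE).
  by apply: proj_equiv_linear; exact: pluecker_lin_free j0.
- apply: (general_gauss_fiber_locus char_k unitQ expo_dil0) => [w wt wn|t0 nt0].
    exact: toric_expo_y_torus.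
  exact: card_irr_component.
Qed.

End ExplicitWeights.

(** * From subsets of lattices to exponent vectors *)

(** A closed point of the torus of [M] is determined by its values on a basis,
    which may be any nonzero scalars. *)
Lemma toric_varietyE (k : closedFieldType) (M : zmodType) (r : nat)
    (f : {additive M -> 'rV[int]_r}) (A : seq M) : bijective f ->
  toric_variety k A = toric (fun i : 'I_(size A) => f A`_i).
Proof.
move=> [g fK gK]; rewrite /toric_variety /toric; congr zclosure.
have gD : {morph g : x y / x + y}.
  by move=> x y; apply: (can_inj fK); rewrite raddfD /= !gK.
have g0 : g 0 = 0 by apply: (can_inj fK); rewrite raddf0 gK.
rewrite eqEsubset; split=> [_ [t [t1 tM] <-]|_ [t nt <-]].
  have tn u : t u != 0.
    by apply: contraTneq (oner_neq0 k) => tu; rewrite negbK -t1 -(subrr u) tM tu mul0r.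
  have tN u : t (- u) = (t u)^-1.
    by apply: (mulfI (tn u)); rewrite -tM subrr t1 divff.
  pose T : 'rV[k]_r := \row_l t (g (delta_mx 0 l)).
  have nT : in_torus T by move=> l; rewrite mxE.
  have gMn u (d : nat) : t (g (u *+ d)) = t (g u) ^+ d.
    elim: d => [|d IHd]; first by rewrite mulr0n g0 t1.
    by rewrite mulrS gD tM IHd exprS.
  have gN u : g (- u) = - g u.
    by apply: (addrI (g u)); rewrite -gD !subrr g0.
  have gMz u (z : int) : t (g (u *~ z)) = t (g u) ^ z.
    by case: z => d; rewrite ?NegzE ?mulrNz ?gN ?tN -?pmulrn gMn.
  exists T => //; apply/rowP => i; rewrite !mxE -{2}[A`_i]fK; set u := f _.
  rewrite {2}[u]row_sum_delta (big_morph (fun x => t (g x)) (id1 := 1) (op1 := *%R)); last 2 first.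
  - by move=> x y; rewrite gD tM.
  - by rewrite g0.
  by rewrite /mon; apply: eq_bigr => l _; rewrite mxE -gMz -scaler_int intz.
exists (fun u => mon t (f u)); last by apply/rowP => i; rewrite !mxE.
by split=> [|u v]; rewrite ?raddf0 ?mon0 // raddfD monD.
Qed.

Lemma Aff_nonempty (M : zmodType) (A : seq M) : Aff A = [set: M] -> (0 < size A)%N.
Proof.
case: A => // AT; have : Aff [::] (0 : M) by rewrite AT.
by move=> [a []]; rewrite big_ord0.
Qed.

Lemma Aff_gen (M : zmodType) (r : nat) (f : {additive M -> 'rV[int]_r}) (A : seq M)
    (j0 : 'I_(size A)) : bijective f -> Aff A = [set: M] ->
  forall z : 'rV[int]_r, exists beta : 'I_(size A) -> int,
    z = \sum_(j < size A) (f A`_j - f A`_j0) *~ beta j.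
Proof.
move=> [g fK gK] AT z; have : Aff A (g (z + f A`_j0)) by rewrite AT.
move=> [beta [sum1 /(congr1 f)]]; rewrite gK raddf_sum => /= zE; exists beta.
apply: (addIr (f A`_j0)); rewrite zE.
under [X in X + _]eq_bigr => j _ do rewrite mulrzBl.
rewrite sumrB -mulrz_sumr sum1 subrK.
by apply: eq_bigr => j _; rewrite raddfMz.
Qed.

(** A surjection onto a free module is the projection on the first coordinates in
    a suitable basis: in the Smith normal form of [Pi] the diagonal block is
    invertible, as [Pi] has a left inverse [S]. *)
Lemma unimodular_completion (r1 r2 : nat) (Pi : 'M[int]_(r1 + r2, r1)) (S : 'M[int]_(r1, r1 + r2)) :
  S *m Pi = 1%:M -> exists2 Q : 'M[int]_(r1 + r2), Q \in unitmx & lsubmx Q = Pi.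
Proof.
move=> SPi; have [L unitL [R unitR [d _ PiE]]] := int_Smith_normal_form Pi.
set D := \matrix_(i, j) _ in PiE.
have DE : D = col_mx (usubmx D) 0.
  rewrite -[LHS]vsubmxK; congr col_mx; apply/matrixP => i j; rewrite !mxE /=.
  by rewrite gtn_eqF ?mulr0n // ltn_addr.
set D1 := usubmx D in DE.
have {}PiE : Pi = L *m col_mx (D1 *m R) 0 by rewrite PiE DE -mulmxA mul_col_mx mul0mx.
have unitU : D1 *m R \in unitmx.
  have inv : lsubmx (S *m L) *m (D1 *m R) = 1%:M.
    rewrite -SPi PiE [RHS]mulmxA -{2}[S *m L]hsubmxK mul_row_col.
    by rewrite mulmx0 addr0.
  by have [] := mulmx1_unit inv.
exists (L *m block_mx (D1 *m R) 0 0 1%:M).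
  rewrite unitmx_mul unitL /= unitmxE det_ublock det1 mulr1.
  exact: unitU.
rewrite PiE block_mxEh mul_mx_row row_mxKl //.
Qed.

(** The exponents are given here by a function on [nat], so that the number of
    coordinates can be replaced by [r1 + s.+1 + m] without casting vectors. *)
Lemma explicit_gauss_seq (k : closedFieldType) (p : nat) (char_k : p \in [pchar k])
    (c : nat) (c_gt0 : (0 < c)%N) (coprime_c_p : coprime c p)
    (r1 s m : nat) (Q : 'M[int]_(r1 + s.+1)) (v a : 'I_m -> 'rV[int]_s.+1)
    (b : 'rV[int]_s.+1) (j0 : 'I_m)
    (m1 : nat) (a' : 'I_m1 -> 'rV[int]_r1) (i0 : 'I_m1) (alpha : 'I_(r1 + s.+1) -> 'I_m1)
    (N : nat) (h : nat -> 'rV[int]_(r1 + s.+1)) (X := @toric k _ N (fun i => h i)) :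
  Q \in unitmx -> v j0 = 0 ->
  (forall z, exists beta : 'I_m -> int, z = \sum_j v j *~ beta j) ->
  (forall i, lsubmx (row i Q) = a' (alpha i) - a' i0) ->
  (forall l, l != i0 -> exists i, alpha i = l) ->
  (forall j, a j = v j + b) ->
  N = (r1 + s.+1 + m)%N ->
  (forall i : 'I_(r1 + s.+1), h i = row i Q) ->
  (forall j : 'I_m, h (r1 + s.+1 + j)%N = dil_emb p c r1 (v j)) ->
  (forall x, exists w : 'I_N -> int, \sum_i w i = 1 /\ x = \sum_(i < N) h i *~ w i) /\
  [/\ general_gauss_fiber (r1 + s.+1) X (fun F => forall Z, irr_component F Z ->
        proj_equiv (zclosure Z) (toric a' : set 'rV[k]_m1)),
      proj_equiv (zclosure (gauss_image (r1 + s.+1) X)) (toric a : set 'rV[k]_m) &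
      general_gauss_fiber (r1 + s.+1) X (fun F => [set Z | irr_component F Z] #= `I_c)].
Proof.
move=> unitQ v0 v_gen Q_alpha alpha_surj aE NE hL hR; subst N; split=> [x|].
  pose w (i : 'I_(r1 + s.+1)) := (x *m invmx Q) 0 i.
  exists (fun i : 'I_(r1 + s.+1 + m) =>
    match split i with inl i => w i | inr j => if j == j0 then 1 - \sum_l w l else 0 end).
  have E (T : zmodType) (F : 'I_(r1 + s.+1 + m) -> int -> T) : (forall j, F (rshift _ j) 0 = 0) ->
      \sum_i F i (match split i with
         inl i => w i | inr j => if j == j0 then 1 - \sum_l w l else 0 end) =
      \sum_i F (lshift m i) (w i) + F (rshift _ j0) (1 - \sum_l w l).
    move=> F0; rewrite big_split_ord /=; congr (_ + _).
      by apply: eq_bigr => i _; rewrite -[split _]/(split (unsplit (inl i))) unsplitK.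
    rewrite (bigD1 j0) //= [X in _ + X = _]big1 ?addr0 => [|j /negPf nj].
      by rewrite -[split _]/(split (unsplit (inr j0))) unsplitK eqxx.
    by rewrite -[split _]/(split (unsplit (inr j))) unsplitK nj F0.
  split; first by rewrite (E _ (fun _ z => z)) // addrC subrK.
  rewrite (E _ (fun (i : 'I_(r1 + s.+1 + m)) z => h i *~ z)) => [|j]; last exact: mulr0z.
  rewrite hR v0 dil_emb0 mul0rz addr0 -{1}[x](mulmxKV unitQ) mulmx_sum_row.
  by apply: eq_bigr => i _; rewrite hL -scaler_int intz.
have XE : X = toric (expo_xy p Q (expo_dil c r1 v)).
  rewrite /X; congr (toric _); apply/funext => i; case: (splitP i) => l il.
    have -> : i = lshift m l by apply: val_inj.
    by rewrite expo_xyL /= hL.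
  have -> : i = rshift _ l by apply: val_inj.
  by rewrite expo_xyR /= hR.
rewrite XE.
exact: (explicit_gauss char_k c_gt0 coprime_c_p unitQ v0 v_gen Q_alpha alpha_surj aE).
Qed.

Theorem theorem5p1 (k : closedFieldType) (p : nat) (char_k : p \in [pchar k])
    (M' M'' : zmodType) (r' r'' : nat)
    (free_M' : free_of_rank M' r') (free_M'' : free_of_rank M'' r'')
    (A' : seq M') (A'' : seq M'') (uniq_A' : uniq A') (uniq_A'' : uniq A'')
    (Aff_A' : Aff A' = [set: M']) (Aff_A'' : Aff A'' = [set: M''])
    (c : nat) (c_gt0 : (0 < c)%N) (coprime_c_p : coprime c p)
    (n : nat) (def_n : n = (r' + r'')%N) (le_A'_n : (size A' - 1 <= n)%N)
    (r''_ge1 : (1 <= r'')%N) :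
  exists A : seq 'rV[int]_n,
    [/\ uniq A, size A = (n + size A'')%N, Aff A = [set: 'rV[int]_n] &
     let X := toric_variety k A in
     [/\ general_gauss_fiber n X (fun F =>
           forall Z, irr_component F Z ->
             proj_equiv (zclosure Z) (toric_variety k A')),
         proj_equiv (zclosure (gauss_image n X)) (toric_variety k A'') &
         general_gauss_fiber n X (fun F =>
           [set Z | irr_component F Z] #= `I_c)]].
Proof.
have [[f' f'_bij] [f'' f''_bij]] := (free_M', free_M'').
have A'0 := Aff_nonempty Aff_A'; have A''0 := Aff_nonempty Aff_A''.
case: r'' r''_ge1 => // s _ in free_M'' f'' f''_bij def_n *; subst n.
pose i0 := Ordinal A'0; pose j0 := Ordinal A''0.
pose a' (l : 'I_(size A')) := f' A'`_l.
pose a (j : 'I_(size A'')) := f'' A''`_j.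
pose v j := a j - a j0.
(* A' has at most n elements besides its first one; the indices i that are too
   large are sent to the default i0, that is, to the difference 0. *)
pose alpha (i : 'I_(r' + s.+1)) : 'I_(size A') := insubd i0 i.+1.
have alpha_surj l : l != i0 -> exists i, alpha i = l.
  move=> l0; have lgt0 : (0 < l)%N by rewrite lt0n; apply: contraNneq l0 => e; apply/eqP/val_inj.
  have ltl : (l.-1 < r' + s.+1)%N.
    by apply: leq_trans le_A'_n; rewrite prednK // -ltnS -subSn // subn1 /= ltn_ord.
  exists (Ordinal ltl); apply: val_inj; rewrite /alpha /= val_insubd prednK //.
  by rewrite ltn_ord.
pose Pi : 'M[int]_(r' + s.+1, r') := \matrix_i (a' (alpha i) - a' i0).
(* S exists because the differences of A' generate M'. *)
have [S SPi] : exists S : 'M[int]_(r', r' + s.+1), S *m Pi = 1%:M.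
  have ex_row (l : 'I_r') : exists w : 'rV[int]_(r' + s.+1), w *m Pi = delta_mx 0 l.
    have [beta ->] := Aff_gen i0 f'_bij Aff_A' (delta_mx 0 l).
    have ex_i j : exists w : 'rV[int]_(r' + s.+1), w *m Pi = a' j - a' i0.
      have [->|/alpha_surj[i <-]] := eqVneq j i0; first by exists 0; rewrite mul0mx subrr.
      by exists (delta_mx 0 i); rewrite -rowE rowK.
    exists (\sum_j projT1 (cid (ex_i j)) *~ beta j); rewrite mulmx_suml.
    by apply: eq_bigr => j _; case: cid => w /= <-; rewrite -!scaler_int scalemxAl.
  exists (\matrix_l projT1 (cid (ex_row l))); apply/row_matrixP => l.
  by rewrite row_mul rowK row1; case: cid.
have [Q unitQ QPi] := unimodular_completion SPi.
have Q_alpha i : lsubmx (row i Q) = a' (alpha i) - a' i0.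
  by rewrite -[RHS](rowK (fun i => a' (alpha i) - a' i0)) -/Pi -QPi; apply/rowP => l; rewrite !mxE.
pose g x := dil_emb p c r' (f'' x - a j0).
pose A := [seq row i Q | i <- ord_enum (r' + s.+1)] ++ [seq g x | x <- A''].
have size_enum : size (ord_enum (r' + s.+1)) = (r' + s.+1)%N.
  by rewrite -(size_map val) val_ord_enum size_iota.
have p_gt1 : (1 < p)%N by case/andP: char_k => /prime_gt1.
have sizeA : size A = (r' + s.+1 + size A'')%N by rewrite size_cat !size_map size_enum.
have hL (i : 'I_(r' + s.+1)) : A`_i = row i Q.
  rewrite nth_cat size_map size_enum ltn_ord (nth_map i) ?size_enum //.
  congr row; apply: val_inj => /=.
  by rewrite -(nth_map i 0%N val) ?size_enum // val_ord_enum nth_iota.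
have hR (j : 'I_(size A'')) : A`_(r' + s.+1 + j) = dil_emb p c r' (v j).
  by rewrite nth_cat size_map size_enum ltnNge leq_addr /= addKn (nth_map 0).
have v0 : v j0 = 0 by rewrite /v subrr.
have [AffA [fib img num]] := explicit_gauss_seq char_k c_gt0 coprime_c_p (v := v) (a := a)
  (b := a j0) (N := size A) (h := fun i => A`_i) unitQ v0 (Aff_gen j0 f''_bij Aff_A'')
  Q_alpha alpha_surj (fun j => esym (subrK _ _)) sizeA hL hR.
exists A; split=> //.
- rewrite cat_uniq; apply/and3P; split.
  + rewrite map_inj_uniq ?ord_enum_uniq // => i j /(congr1 (mulmx^~ (invmx Q))).
    rewrite -!row_mul mulmxV // !row1 => /rowP/(_ i)/eqP.
    by rewrite !mxE !eqxx /=; have [-> //|_] := eqVneq i j; rewrite oner_eq0.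
  (* A row of a unimodular matrix is not divisible by p. *)
  + apply/hasPn => _ /mapP[x _ ->]; apply/mapP => -[i _].
    move=> /(congr1 (mulmx^~ (invmx Q)))/rowP/(_ i).
    rewrite -row_mul mulmxV // row1 /g /dil_emb -scaler_nat -scalemxAl !mxE !eqxx.
    move=> /(congr1 absz); rewrite abszM natz absz_nat => /eqP.
    by rewrite muln_eq1 (gtn_eqF p_gt1).
  rewrite map_inj_uniq // => x y /rowP gxy.
  apply: (bij_inj f''_bij); apply: (addIr (- a j0)); apply/rowP => l.
  have := gxy (rshift r' l); rewrite /g /dil_emb !mulmxnE !row_mxEr.
  move=> /(Num.Theory.pmulrnI (ltnW p_gt1)); rewrite [LHS]mxE [RHS]mxE.
  by move=> e; apply: (Num.Theory.pmulrnI (dil_factor_gt0 c_gt0 l)).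

- rewrite eqEsubset; split=> // x _; have [w [w1 xE]] := AffA x.
  by exists w.
have XE : toric_variety k A = toric (fun i : 'I_(size A) => A`_i).
  by apply: (@toric_varietyE k _ _ idfun); exists idfun.
rewrite /= XE (toric_varietyE k A' f'_bij) (toric_varietyE k A'' f''_bij).
by split.
Qed.
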